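(* Let $(A,\Delta)$ be a multiplier Hopf $^*$-algebra, let $h$ be a group-like projection in $A$, and let $C$ be the right leg of $\Delta(h)$. Then $C$ is a $^*$-subalgebra of $A$ and $\Delta(C)(A\otimes 1)\subseteq A\otimes C$. Moreover $h\in C$.
   Context: Algebras are over $\mathbb C$, possibly without identity, with non-degenerate product; $\otimes$ is the algebraic tensor product, $M(A)$ is the multiplier algebra of $A$. A multiplier Hopf $^*$-algebra is a $^*$-algebra $A$ with a non-degenerate coassociative $^*$-homomorphism $\Delta:A\to M(A\otimes A)$ such that $a\otimes b\mapsto\Delta(a)(1\otimes b)$ and $a\otimes b\mapsto(a\otimes1)\Delta(b)$ are bijections from $A\otimes A$ onto $A\otimes A$ (by taking adjoints, also $\Delta(a)(b\otimes 1)$ and $(1\otimes a)\Delta(b)$ lie in $A\otimes A$). A group-like projection is a non-zero $h\in A$ with $h^2=h=h^*$ and $\Delta(h)(1\otimes h)=h\otimes h$. The right leg of $\Delta(a)$, for $a\in A$, is the smallest subspace $C$ of $A$ such that $\Delta(a)(a'\otimes1)\in A\otimes C$ for all $a'\in A$ (equivalently, such that $(a'\otimes1)\Delta(a)\in A\otimes C$ for all $a'\in A$). *)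

(* Defs.v *)
From HB Require Import structures.
From mathcomp Require Import all_boot all_order all_algebra.
From mathcomp Require Import complex.
From mathcomp Require Import boolp classical_sets reals.

Set Implicit Arguments.
Unset Strict Implicit.
Unset Printing Implicit Defensive.

Import GRing.Theory Num.Theory.
Local Open Scope quotient_scope.
Local Open Scope classical_set_scope.
Local Open Scope ring_scope.
Local Obligation Tactic := cbn beta.

Reserved Notation "V ⊗ W" (at level 40, left associativity).
Reserved Notation "a • b" (at level 40, left associativity).


Section TensorProduct.
Variables (K : comPzRingType) (V W : lmodType K).

(* A list [:: (v1, w1); ...; (vn, wn)] stands for the formal sum of the
   v_i ⊗ w_i; [teq] is the congruence generated by commutativity of the sum
   and the bilinearity relations. *)
Inductive teq : seq (V * W) -> seq (V * W) -> Prop :=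
| teq_refl s : teq s s
| teq_sym s t : teq s t -> teq t s
| teq_trans s t u : teq s t -> teq t u -> teq s u
| teq_cat s s' t t' : teq s s' -> teq t t' -> teq (s ++ t) (s' ++ t')
| teq_catC s t : teq (s ++ t) (t ++ s)
| teq_0 w : teq [:: (0, w)] [::]
| teq_Dl v v' w : teq [:: (v + v', w)] [:: (v, w); (v', w)]
| teq_Dr v w w' : teq [:: (v, w + w')] [:: (v, w); (v, w')]
| teq_Z k v w : teq [:: (k *: v, w)] [:: (v, k *: w)].

Definition teqb (s t : seq (V * W)) : bool := `[< teq s t >].

Lemma teqb_refl : reflexive teqb.
Proof. by move=> s; apply/asboolP/teq_refl. Qed.

Lemma teqb_sym : symmetric teqb.
Proof. by move=> s t; apply/asboolP/asboolP; apply: teq_sym. Qed.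

Lemma teqb_trans : transitive teqb.
Proof.
by move=> t s u /asboolP st /asboolP tu; apply/asboolP; apply: teq_trans st tu.
Qed.

Canonical teq_equiv := EquivRel teqb teqb_refl teqb_sym teqb_trans.

Definition tensor := {eq_quot teq_equiv}.
HB.instance Definition _ := Choice.on tensor.
HB.instance Definition _ := EqQuotient.on tensor.

Definition tpi (s : seq (V * W)) : tensor := \pi_tensor s.
Definition pure (v : V) (w : W) : tensor := tpi [:: (v, w)].

Lemma tpiP s t : tpi s = tpi t <-> teq s t.
Proof.
rewrite /tpi; split; first by move/eqquotP/asboolP.
by move=> st; apply/eqquotP/asboolP.
Qed.

Lemma reprK_tpi x : tpi (repr x) = x. Proof. exact: reprK. Qed.

Lemma teq_repr s : teq (repr (tpi s)) s.
Proof. by apply/tpiP; rewrite reprK_tpi. Qed.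

Lemma tpi_ind (P : tensor -> Prop) : (forall s, P (tpi s)) -> forall x, P x.
Proof. by move=> Ps x; rewrite -(reprK_tpi x). Qed.

Definition scale_seq k (s : seq (V * W)) := [seq (k *: p.1, p.2) | p <- s].

Lemma teq_0r v : teq [:: (v, 0)] [::].
Proof.
rewrite -(scale0r (0 : W)); apply: teq_trans (teq_sym (teq_Z 0 v 0)) _.
by rewrite scale0r; apply: teq_0.
Qed.

Lemma teq_scale k s t : teq s t -> teq (scale_seq k s) (scale_seq k t).
Proof.
elim=> {s t} [s|s t _|s t u _ st _|s s' t t' _ ss _ tt|s t|w|v v' w|v w w'|a v w] /=.
- exact: teq_refl.
- exact: teq_sym.
- exact: teq_trans.
- by rewrite /scale_seq !map_cat; apply: teq_cat.
- by rewrite /scale_seq !map_cat; apply: teq_catC.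
- by rewrite /scale_seq /= scaler0; apply: teq_0.
- by rewrite /scale_seq /= scalerDr; apply: teq_Dl.
- exact: teq_Dr.
- by rewrite /scale_seq /= scalerA mulrC -scalerA; apply: teq_Z.
Qed.

Definition tadd (x y : tensor) : tensor := tpi (repr x ++ repr y).
Definition tscale k (x : tensor) : tensor := tpi (scale_seq k (repr x)).
Definition topp (x : tensor) : tensor := tscale (- 1) x.

Lemma taddE s t : tadd (tpi s) (tpi t) = tpi (s ++ t).
Proof. by apply/tpiP; apply: teq_cat; apply: teq_repr. Qed.

Lemma tscaleE k s : tscale k (tpi s) = tpi (scale_seq k s).
Proof. by apply/tpiP; apply: teq_scale; apply: teq_repr. Qed.

Lemma taddA : associative tadd.
Proof.
by elim/tpi_ind=> s; elim/tpi_ind=> t; elim/tpi_ind=> u; rewrite !taddE catA.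
Qed.

Lemma taddC : commutative tadd.
Proof.
elim/tpi_ind=> s; elim/tpi_ind=> t; rewrite !taddE.
by apply/tpiP; apply: teq_catC.
Qed.

Lemma tadd0 : left_id (tpi [::]) tadd.
Proof. by elim/tpi_ind=> s; rewrite taddE. Qed.

Lemma tscaleDl_subproof x : {morph tscale^~ x : a b / a + b >-> tadd a b}.
Proof.
move: x; elim/tpi_ind=> s a b; rewrite !tscaleE taddE; apply/tpiP.
elim: s => [|[v w] s IHs] /=; first exact: teq_refl.
rewrite scalerDl.
have h : teq (((a *: v + b *: v, w) :: scale_seq (a + b) s))
             ([:: (a *: v, w); (b *: v, w)] ++ (scale_seq a s ++ scale_seq b s)).
  by rewrite -cat1s; apply: teq_cat => //; apply: teq_Dl.
apply: teq_trans h _; rewrite /= -(cat1s (a *: v, w)) -[(a *: v, w) :: (_ ++ _)]cat1s.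
apply: teq_cat; first exact: teq_refl.
rewrite -(cat1s (b *: v, w)) -(cat1s _ (scale_seq b s)) !catA.
by apply: teq_cat; [apply: teq_catC | apply: teq_refl].
Qed.

Lemma tscale0 x : tscale 0 x = tpi [::].
Proof.
move: x; elim/tpi_ind=> s; rewrite tscaleE; apply/tpiP.
elim: s => [|[v w] s IHs] /=; first exact: teq_refl.
rewrite -(cat1s _ (scale_seq 0 s)) -[[::]]/([::] ++ [::]) scale0r.
by apply: teq_cat IHs; apply: teq_0.
Qed.

Lemma tscale1 : left_id 1 tscale.
Proof.
elim/tpi_ind=> s; rewrite tscaleE; congr tpi.
by elim: s => //= -[v w] s ->; rewrite scale1r.
Qed.

Lemma taddN : left_inverse (tpi [::]) topp tadd.
Proof.
move=> x; rewrite /topp -[x in tadd _ x]tscale1 -tscaleDl_subproof addNr.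
exact: tscale0.
Qed.

HB.instance Definition _ := GRing.isZmodule.Build tensor taddA taddC tadd0 taddN.

Lemma tscaleA a b (x : tensor) : tscale a (tscale b x) = tscale (a * b) x.
Proof.
move: x; elim/tpi_ind=> s; rewrite !tscaleE /scale_seq -map_comp; congr tpi.
by apply: eq_map => p /=; rewrite scalerA.
Qed.

Lemma tscaleDr : right_distributive tscale +%R.
Proof.
move=> k; elim/tpi_ind=> s; elim/tpi_ind=> t.
by rewrite -[_ + _]/(tadd _ _) taddE !tscaleE -[RHS]/(tadd _ _) taddE /scale_seq map_cat.
Qed.

Lemma tscaleDl (x : tensor) : {morph tscale^~ x : a b / a + b}.
Proof. exact: tscaleDl_subproof. Qed.

HB.instance Definition _ :=
  GRing.Zmodule_isLmodule.Build K tensor tscaleA tscale1 tscaleDr tscaleDl.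

Lemma tpi_cat s t : tpi (s ++ t) = tpi s + tpi t.
Proof. by rewrite -[RHS]/(tadd _ _) taddE. Qed.

Lemma tpi_sum s : tpi s = \sum_(p <- s) pure p.1 p.2.
Proof.
elim: s => [|[v w] s IHs]; first by rewrite big_nil.
by rewrite big_cons -IHs -cat1s tpi_cat.
Qed.

Lemma pureDl v v' w : pure (v + v') w = pure v w + pure v' w.
Proof. by rewrite -tpi_cat; apply/tpiP; apply: teq_Dl. Qed.

Lemma pureDr v w w' : pure v (w + w') = pure v w + pure v w'.
Proof. by rewrite -tpi_cat; apply/tpiP; apply: teq_Dr. Qed.

Lemma pureZl k v w : pure (k *: v) w = k *: pure v w.
Proof. by rewrite -[RHS]/(tscale _ _) tscaleE. Qed.

Lemma pureZr k v w : pure v (k *: w) = k *: pure v w.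
Proof. by rewrite -pureZl; apply/tpiP; apply: teq_sym; apply: teq_Z. Qed.

Lemma tensor_ind (P : tensor -> Prop) :
  P 0 -> (forall x y, P x -> P y -> P (x + y)) ->
  (forall v w, P (pure v w)) -> forall x, P x.
Proof.
move=> P0 PD Pp; elim/tpi_ind=> s; rewrite tpi_sum.
by elim/big_ind: _ => // p _; apply: Pp.
Qed.


Section Lift.
Variables (U : nmodType) (f : V -> W -> U).

Definition balanced :=
  [/\ forall v v' w, f (v + v') w = f v w + f v' w,
      forall v w w', f v (w + w') = f v w + f v w',
      forall w, f 0 w = 0
    & forall k v w, f (k *: v) w = f v (k *: w)].

(* The representative of x is irrelevant when f is balanced. *)
Definition tlift (x : tensor) : U := \sum_(p <- repr x) f p.1 p.2.

Hypothesis fB : balanced.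

Lemma tlift_teq s t : teq s t ->
  \sum_(p <- s) f p.1 p.2 = \sum_(p <- t) f p.1 p.2.
Proof.
case: fB => fDl fDr f0 fZ.
elim=> {s t} [s|s t _ ->|s t u _ -> _ ->|s s' t t' _ ss _ tt|s t|w|v v' w|v w w'|a v w] //.
- by rewrite !big_cat /= ss tt.
- by rewrite !big_cat /= addrC.
- by rewrite big_seq1 big_nil f0.
- by rewrite !big_cons big_nil /= fDl !addr0.
- by rewrite !big_cons big_nil /= fDr !addr0.
- by rewrite !big_seq1 fZ.
Qed.

Lemma tlift_tpi s : tlift (tpi s) = \sum_(p <- s) f p.1 p.2.
Proof. by apply: tlift_teq; apply: teq_repr. Qed.

Lemma tliftE v w : tlift (pure v w) = f v w.
Proof. by rewrite tlift_tpi big_seq1. Qed.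

Lemma tlift0 : tlift 0 = 0.
Proof. by rewrite -[0]/(tpi [::]) tlift_tpi big_nil. Qed.

Lemma tliftD x y : tlift (x + y) = tlift x + tlift y.
Proof.
move: x y; elim/tpi_ind=> s; elim/tpi_ind=> t.
by rewrite -tpi_cat !tlift_tpi big_cat.
Qed.

End Lift.

Definition bilin (U : lmodType K) (f : V -> W -> U) :=
  (forall w, linear (f^~ w)) /\ (forall v, linear (f v)).

Lemma bilin_balanced (U : lmodType K) (f : V -> W -> U) : bilin f -> balanced f.
Proof.
move=> [fl fr]; have f0l w : f 0 w = 0.
  by have := fl w (-1) 0 0; rewrite scaler0 addr0 scaleN1r addNr.
have f0r v : f v 0 = 0.
  by have := fr v (-1) 0 0; rewrite scaler0 addr0 scaleN1r addNr.
split=> //.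
- by move=> v v' w; have := fl w 1 v v'; rewrite !scale1r.
- by move=> v w w'; have := fr v 1 w w'; rewrite !scale1r.
- move=> k v w; have := fl w k v 0; rewrite addr0 => ->; have := fr v k w 0.
  by rewrite addr0 => ->; rewrite f0l f0r.
Qed.

Lemma tlift_linear (U : lmodType K) (f : V -> W -> U) : bilin f -> linear (tlift f).
Proof.
move=> fB; have fb := bilin_balanced fB; move=> k x y; rewrite tliftD //.
congr (_ + _); elim/tensor_ind: x => [|x x' ihx ihx'|v w].
- by rewrite scaler0 tlift0 // scaler0.
- by rewrite scalerDr !tliftD // ihx ihx' scalerDr.
- rewrite -pureZl !tliftE //; have := fB.1 w k v 0; rewrite addr0 => ->.
  by case: fb => _ _ -> _; rewrite addr0.
Qed.

End TensorProduct.

Arguments tpi {K V W} s.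
Arguments tlift {K V W U} f x.

Notation "V ⊗ W" := (tensor V%type W%type) : type_scope.
Notation "v ⊗ w" := (pure v w) : ring_scope.

Section TensorMaps.
Variables (K : comPzRingType).

Lemma pure_bilin (V W : lmodType K) : bilin (@pure K V W).
Proof.
by split=> [w|v] k x y; rewrite ?pureDl ?pureZl // pureDr pureZr.
Qed.

Lemma tensor_eq (V W U : lmodType K) (f g : V ⊗ W -> U) :
  linear f -> linear g -> (forall v w, f (v ⊗ w) = g (v ⊗ w)) -> f =1 g.
Proof.
move=> fl gl fg x; have f0 : f 0 = 0.
  by have := fl (-1) 0 0; rewrite scaler0 addr0 scaleN1r addNr.
have g0 : g 0 = 0.
  by have := gl (-1) 0 0; rewrite scaler0 addr0 scaleN1r addNr.
elim/tensor_ind: x => [|x y fx fy|//]; first by rewrite f0 g0.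
by have := fl 1 x y; have := gl 1 x y; rewrite !scale1r => -> ->; rewrite fx fy.
Qed.

Definition tmap (V V' W W' : lmodType K) (f : V -> V') (g : W -> W')
  : V ⊗ W -> V' ⊗ W' := tlift (fun v w => f v ⊗ g w).

Section Tmap.
Variables (V V' W W' : lmodType K) (f : V -> V') (g : W -> W').
Hypotheses (fl : linear f) (gl : linear g).

Lemma tmap_bilin : bilin (fun v w => f v ⊗ g w).
Proof.
by split=> [w|v] k x y; rewrite ?fl ?gl ?pureDl ?pureZl // pureDr pureZr.
Qed.

Lemma tmap_linear : linear (tmap f g).
Proof. exact: tlift_linear tmap_bilin. Qed.

Lemma tmapE v w : tmap f g (v ⊗ w) = f v ⊗ g w.
Proof. exact: (tliftE (bilin_balanced tmap_bilin)). Qed.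

End Tmap.

(* The canonical isomorphism (U ⊗ V) ⊗ W -> U ⊗ (V ⊗ W). *)
Definition tassoc (U V W : lmodType K) : (U ⊗ V) ⊗ W -> U ⊗ (V ⊗ W) :=
  tlift (fun x w => tlift (fun u v => u ⊗ (v ⊗ w)) x).

Lemma tassoc_bilin1 (U V W : lmodType K) (w : W) :
  bilin (fun (u : U) (v : V) => u ⊗ (v ⊗ w)).
Proof.
by split=> [v|u] k x y; rewrite ?pureDl ?pureZl // ?pureDr ?pureZr.
Qed.

Lemma tassoc_bilin (U V W : lmodType K) :
  bilin (fun (x : U ⊗ V) (w : W) => tlift (fun u v => u ⊗ (v ⊗ w)) x).
Proof.
split=> [w|x]; first exact: tlift_linear (tassoc_bilin1 _ _ w).
move=> k w w'; elim/tensor_ind: x => [|x y ihx ihy|u v].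
- by rewrite !tlift0 ?scaler0 ?addr0 //; apply/bilin_balanced/tassoc_bilin1.
- rewrite !tliftD; try exact/bilin_balanced/tassoc_bilin1.
  by rewrite ihx ihy scalerDr addrACA.
- rewrite !tliftE; try exact/bilin_balanced/tassoc_bilin1.
  by rewrite !pureDr !pureZr.
Qed.

Lemma tassocE (U V W : lmodType K) (u : U) (v : V) (w : W) :
  tassoc ((u ⊗ v) ⊗ w) = u ⊗ (v ⊗ w).
Proof.
rewrite /tassoc tliftE ?tliftE //; apply: bilin_balanced.
- exact: tassoc_bilin1.
- exact: tassoc_bilin.
Qed.

End TensorMaps.


HB.mixin Record isNuAlgebra (K : pzRingType) A of GRing.Lmodule K A := {
  nmul : A -> A -> A;
  nmulA : associative nmul;
  nmul_linearl : forall b : A, linear (nmul^~ b);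
  nmul_linearr : forall a : A, linear (nmul a)
}.

#[short(type="nuAlgType")]
HB.structure Definition NuAlgebra (K : pzRingType) :=
  { A of GRing.Lmodule K A & isNuAlgebra K A }.

Notation "a • b" := (nmul a b) : ring_scope.

HB.mixin Record hasStar (K : numClosedFieldType) A of NuAlgebra K A := {
  star : A -> A;
  starK : involutive star;
  starD : {morph star : a b / a + b};
  starZ : forall k a, star (k *: a) = k^* *: star a;
  starM : forall a b, star (nmul a b) = nmul (star b) (star a)
}.

#[short(type="starAlgType")]
HB.structure Definition StarAlgebra (K : numClosedFieldType) :=
  { A of NuAlgebra K A & hasStar K A }.

Section NuAlgebraTheory.
Variables (K : pzRingType) (A : nuAlgType K).

Lemma nmulDl (a b c : A) : (a + b) • c = a • c + b • c.
Proof. by have := nmul_linearl c 1 a b; rewrite !scale1r. Qed.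

Lemma nmulDr (a b c : A) : a • (b + c) = a • b + a • c.
Proof. by have := nmul_linearr a 1 b c; rewrite !scale1r. Qed.

Lemma nmul0l (a : A) : 0 • a = 0.
Proof. by apply: (addrI (0 • a)); rewrite -nmulDl !addr0. Qed.

Lemma nmul0r (a : A) : a • 0 = 0.
Proof. by apply: (addrI (a • 0)); rewrite -nmulDr !addr0. Qed.

Lemma nmulZl k (a b : A) : (k *: a) • b = k *: (a • b).
Proof. by have := nmul_linearl b k a 0; rewrite nmul0l !addr0. Qed.

Lemma nmulZr k (a b : A) : a • (k *: b) = k *: (a • b).
Proof. by have := nmul_linearr a k b 0; rewrite nmul0r !addr0. Qed.

Definition nondegenerate_product :=
  (forall a : A, (forall b, a • b = 0) -> a = 0) /\
  (forall a : A, (forall b, b • a = 0) -> a = 0).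

End NuAlgebraTheory.

Arguments nondegenerate_product {K} A.

Lemma star0 (K : numClosedFieldType) (A : starAlgType K) : star (0 : A) = 0.
Proof. by apply: (addrI (star 0)); rewrite -starD !addr0. Qed.

Definition nu_hom (K : pzRingType) (A B : nuAlgType K) (f : A -> B) :=
  linear f /\ {morph f : a b / a • b}.

Definition star_hom (K : numClosedFieldType) (A B : starAlgType K) (f : A -> B) :=
  nu_hom f /\ {morph f : a / star a}.


Section TensorAlgebra.
Variables (K : comPzRingType) (A B : nuAlgType K).

Definition tmul (x y : A ⊗ B) : A ⊗ B :=
  tlift (fun a b => tmap (nmul a) (nmul b) y) x.

Lemma tmul_bilin (y : A ⊗ B) : bilin (fun a b => tmap (nmul a) (nmul b) y).
Proof.
split=> [b k a a'|a k b b'].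
- elim/tensor_ind: y => [|x y ihx ihy|v w].
  + by rewrite /tmap !tlift0 ?scaler0 ?addr0 //;
      apply/bilin_balanced/tmap_bilin; apply: nmul_linearr.
  + have D c : tmap (nmul c) (nmul b) (x + y) =
      tmap (nmul c) (nmul b) x + tmap (nmul c) (nmul b) y.
      by apply/tliftD/bilin_balanced/tmap_bilin; apply: nmul_linearr.
    by rewrite !D ihx ihy scalerDr addrACA.
  + rewrite !tmapE; try exact: nmul_linearr.
    by rewrite nmulDl nmulZl pureDl pureZl.
- elim/tensor_ind: y => [|x y ihx ihy|v w].
  + by rewrite /tmap !tlift0 ?scaler0 ?addr0 //;
      apply/bilin_balanced/tmap_bilin; apply: nmul_linearr.
  + have D c : tmap (nmul a) (nmul c) (x + y) =
      tmap (nmul a) (nmul c) x + tmap (nmul a) (nmul c) y.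
      by apply/tliftD/bilin_balanced/tmap_bilin; apply: nmul_linearr.
    by rewrite !D ihx ihy scalerDr addrACA.
  + rewrite !tmapE; try exact: nmul_linearr.
    by rewrite nmulDl nmulZl pureDr pureZr.
Qed.

Lemma tmul_linearl (y : A ⊗ B) : linear (tmul^~ y).
Proof. exact: tlift_linear (tmul_bilin y). Qed.

Lemma tmulDl (x x' y : A ⊗ B) : tmul (x + x') y = tmul x y + tmul x' y.
Proof. by have := tmul_linearl y 1 x x'; rewrite !scale1r. Qed.

Lemma tmul0l (y : A ⊗ B) : tmul 0 y = 0.
Proof. by apply: (addrI (tmul 0 y)); rewrite -tmulDl !addr0. Qed.

Lemma tmul_pure a b (y : A ⊗ B) : tmul (a ⊗ b) y = tmap (nmul a) (nmul b) y.
Proof. exact: (tliftE (bilin_balanced (tmul_bilin y))). Qed.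

Lemma tmul_linearr (x : A ⊗ B) : linear (tmul x).
Proof.
move=> k y y'; elim/tensor_ind: x => [|x x' ihx ihx'|a b].
- by rewrite !tmul0l scaler0 addr0.
- by rewrite !tmulDl ihx ihx' scalerDr addrACA.
- by rewrite !tmul_pure tmap_linear //; apply: nmul_linearr.
Qed.

Lemma tmulE a b a' b' : tmul (a ⊗ b) (a' ⊗ b') = (a • a') ⊗ (b • b').
Proof. by rewrite tmul_pure tmapE //; apply: nmul_linearr. Qed.

Lemma tmulDr (x y y' : A ⊗ B) : tmul x (y + y') = tmul x y + tmul x y'.
Proof. by have := tmul_linearr x 1 y y'; rewrite !scale1r. Qed.

Lemma tmul0r (x : A ⊗ B) : tmul x 0 = 0.
Proof. by apply: (addrI (tmul x 0)); rewrite -tmulDr !addr0. Qed.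

Lemma tmulA : associative tmul.
Proof.
move=> x y z; elim/tensor_ind: x => [|x x' ihx ihx'|a b].
- by rewrite !tmul0l.
- by rewrite !tmulDl ihx ihx'.
elim/tensor_ind: y => [|y y' ihy ihy'|a' b'].
- by rewrite tmul0l tmul0r tmul0l.
- by rewrite !(tmulDl, tmulDr) ihy ihy'.
elim/tensor_ind: z => [|z z' ihz ihz'|a'' b''].
- by rewrite !tmul0r.
- by rewrite !tmulDr ihz ihz'.
by rewrite !tmulE !nmulA.
Qed.

HB.instance Definition _ :=
  isNuAlgebra.Build K (tensor A B) tmulA tmul_linearl tmul_linearr.

Lemma nmul_pure (a a' : A) (b b' : B) :
  (a ⊗ b) • (a' ⊗ b') = (a • a') ⊗ (b • b').
Proof. exact: tmulE. Qed.

End TensorAlgebra.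

Section TensorStarAlgebra.
Variables (K : numClosedFieldType) (A B : starAlgType K).

Definition tstar : A ⊗ B -> A ⊗ B := tlift (fun a b => star a ⊗ star b).

Lemma tstar_balanced : balanced (fun (a : A) (b : B) => star a ⊗ star b).
Proof.
split=> [v v' w|v w w'|w|k v w].
- by rewrite starD pureDl.
- by rewrite starD pureDr.
- by rewrite star0 -(scale0r (0 : A)) pureZl scale0r.
- by rewrite !starZ pureZl pureZr.
Qed.

Lemma tstarE a b : tstar (a ⊗ b) = star a ⊗ star b.
Proof. exact: (tliftE tstar_balanced). Qed.

Lemma tstarD : {morph tstar : x y / x + y}.
Proof. exact: (tliftD tstar_balanced). Qed.

Lemma tstar0 : tstar 0 = 0.
Proof. exact: (tlift0 tstar_balanced). Qed.

Lemma tstarK : involutive tstar.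
Proof.
elim/tensor_ind=> [|x y ihx ihy|a b]; first by rewrite !tstar0.
- by rewrite !tstarD ihx ihy.
- by rewrite !tstarE !starK.
Qed.

Lemma tstarZ k x : tstar (k *: x) = k^* *: tstar x.
Proof.
elim/tensor_ind: x => [|x y ihx ihy|a b]; first by rewrite !(scaler0, tstar0).
- by rewrite !(scalerDr, tstarD) ihx ihy.
- by rewrite -pureZl !tstarE starZ pureZl.
Qed.

Lemma tstarM (x y : A ⊗ B) : tstar (x • y) = tstar y • tstar x.
Proof.
elim/tensor_ind: x => [|x x' ihx ihx'|a b].
- by rewrite !(tstar0, nmul0l, nmul0r).
- by rewrite !(tstarD, nmulDl, nmulDr) ihx ihx'.
elim/tensor_ind: y => [|y y' ihy ihy'|a' b'].
- by rewrite !(tstar0, nmul0l, nmul0r).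
- by rewrite !(tstarD, nmulDl, nmulDr) ihy ihy'.
by rewrite !(tstarE, nmul_pure) !starM.
Qed.

HB.instance Definition _ :=
  hasStar.Build K (tensor A B) tstarK tstarD tstarZ tstarM.

End TensorStarAlgebra.


Section Multiplier.
Variables (K : comPzRingType) (A : nuAlgType K).

(* A multiplier m is the pair of maps (a |-> m a, a |-> a m). *)
Record multiplier := Multiplier {
  mulL : A -> A;
  mulR : A -> A;
  mulL_linear : linear mulL;
  mulR_linear : linear mulR;
  mulLM : forall a b, mulL (a • b) = mulL a • b;
  mulRM : forall a b, mulR (a • b) = a • mulR b;
  mulLR : forall a b, a • mulL b = mulR a • b
}.

HB.instance Definition _ := gen_eqMixin multiplier.
HB.instance Definition _ := gen_choiceMixin multiplier.

Lemma multiplierP (m n : multiplier) :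
  mulL m =1 mulL n -> mulR m =1 mulR n -> m = n.
Proof.
case: m n => l r ll rl lM rM lr [l' r' ll' rl' lM' rM' lr'] /= /funext ll'E /funext rr'E.
by subst l' r'; congr Multiplier; apply: Prop_irrelevance.
Qed.

Lemma mulLD (m : multiplier) : {morph mulL m : a b / a + b}.
Proof. by move=> a b; have := mulL_linear m 1 a b; rewrite !scale1r. Qed.

Lemma mulRD (m : multiplier) : {morph mulR m : a b / a + b}.
Proof. by move=> a b; have := mulR_linear m 1 a b; rewrite !scale1r. Qed.

Lemma mulL0 (m : multiplier) : mulL m 0 = 0.
Proof. by apply: (addrI (mulL m 0)); rewrite -mulLD !addr0. Qed.

Lemma mulR0 (m : multiplier) : mulR m 0 = 0.
Proof. by apply: (addrI (mulR m 0)); rewrite -mulRD !addr0. Qed.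

Lemma mulLZ (m : multiplier) k a : mulL m (k *: a) = k *: mulL m a.
Proof. by have := mulL_linear m k a 0; rewrite mulL0 !addr0. Qed.

Lemma mulRZ (m : multiplier) k a : mulR m (k *: a) = k *: mulR m a.
Proof. by have := mulR_linear m k a 0; rewrite mulR0 !addr0. Qed.

Program Definition mzero : multiplier :=
  @Multiplier (fun=> 0) (fun=> 0) _ _ _ _ _.
Next Obligation. by move=> k a b; rewrite scaler0 addr0. Qed.
Next Obligation. by move=> k a b; rewrite scaler0 addr0. Qed.
Next Obligation. by move=> a b; rewrite nmul0l. Qed.
Next Obligation. by move=> a b; rewrite nmul0r. Qed.
Next Obligation. by move=> a b; rewrite nmul0l nmul0r. Qed.

Program Definition madd (m n : multiplier) : multiplier :=
  @Multiplier (fun a => mulL m a + mulL n a) (fun a => mulR m a + mulR n a) _ _ _ _ _.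
Next Obligation.
by move=> m n k a b; rewrite !mulL_linear scalerDr addrACA.
Qed.
Next Obligation.
by move=> m n k a b; rewrite !mulR_linear scalerDr addrACA.
Qed.
Next Obligation. by move=> m n a b; rewrite !mulLM nmulDl. Qed.
Next Obligation. by move=> m n a b; rewrite !mulRM nmulDr. Qed.
Next Obligation. by move=> m n a b; rewrite nmulDl nmulDr !mulLR. Qed.

Program Definition mscale (k : K) (m : multiplier) : multiplier :=
  @Multiplier (fun a => k *: mulL m a) (fun a => k *: mulR m a) _ _ _ _ _.
Next Obligation.
by move=> k m c a b; rewrite mulL_linear scalerDr !scalerA mulrC.
Qed.
Next Obligation.
by move=> k m c a b; rewrite mulR_linear scalerDr !scalerA mulrC.
Qed.
Next Obligation. by move=> k m a b; rewrite mulLM nmulZl. Qed.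
Next Obligation. by move=> k m a b; rewrite mulRM nmulZr. Qed.
Next Obligation. by move=> k m a b; rewrite nmulZl nmulZr mulLR. Qed.

Program Definition mmul (m n : multiplier) : multiplier :=
  @Multiplier (fun a => mulL m (mulL n a)) (fun a => mulR n (mulR m a)) _ _ _ _ _.
Next Obligation. by move=> m n k a b; rewrite !mulL_linear. Qed.
Next Obligation. by move=> m n k a b; rewrite !mulR_linear. Qed.
Next Obligation. by move=> m n a b; rewrite !mulLM. Qed.
Next Obligation. by move=> m n a b; rewrite !mulRM. Qed.
Next Obligation. by move=> m n a b; rewrite !mulLR. Qed.

Program Definition mone : multiplier := @Multiplier id id _ _ _ _ _.
Next Obligation. by []. Qed.
Next Obligation. by []. Qed.
Next Obligation. by []. Qed.
Next Obligation. by []. Qed.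
Next Obligation. by []. Qed.

(* The canonical map A -> M(A), injective when the product of A is
   nondegenerate. *)
Program Definition membed (a : A) : multiplier :=
  @Multiplier (nmul a) (nmul^~ a) _ _ _ _ _.
Next Obligation. exact: nmul_linearr. Qed.
Next Obligation. exact: nmul_linearl. Qed.
Next Obligation. by move=> a b c; rewrite nmulA. Qed.
Next Obligation. by move=> a b c; rewrite nmulA. Qed.
Next Obligation. by move=> a b c; rewrite nmulA. Qed.

Lemma maddA : associative madd.
Proof. by move=> m n p; apply: multiplierP => a /=; rewrite addrA. Qed.

Lemma maddC : commutative madd.
Proof. by move=> m n; apply: multiplierP => a /=; rewrite addrC. Qed.

Lemma madd0 : left_id mzero madd.
Proof. by move=> m; apply: multiplierP => a /=; rewrite add0r. Qed.

Lemma maddN : left_inverse mzero (mscale (-1)) madd.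
Proof.
by move=> m; apply: multiplierP => a /=; rewrite scaleN1r addNr.
Qed.

HB.instance Definition _ :=
  GRing.isZmodule.Build multiplier maddA maddC madd0 maddN.

Lemma mscaleA a b (m : multiplier) : mscale a (mscale b m) = mscale (a * b) m.
Proof. by apply: multiplierP => c /=; rewrite scalerA. Qed.

Lemma mscale1 : left_id 1 mscale.
Proof. by move=> m; apply: multiplierP => c /=; rewrite scale1r. Qed.

Lemma mscaleDr : right_distributive mscale +%R.
Proof. by move=> k m n; apply: multiplierP => c /=; rewrite scalerDr. Qed.

Lemma mscaleDl (m : multiplier) : {morph mscale^~ m : a b / a + b}.
Proof. by move=> k l; apply: multiplierP => c /=; rewrite scalerDl. Qed.

HB.instance Definition _ :=
  GRing.Zmodule_isLmodule.Build K multiplier mscaleA mscale1 mscaleDr mscaleDl.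

Lemma mmulA : associative mmul.
Proof. by move=> m n p; apply: multiplierP. Qed.

Lemma mmul_linearl (n : multiplier) : linear (mmul^~ n).
Proof.
by move=> k m m'; apply: multiplierP => a //=; rewrite mulRD mulRZ.
Qed.

Lemma mmul_linearr (m : multiplier) : linear (mmul m).
Proof.
by move=> k n n'; apply: multiplierP => a //=; rewrite mulLD mulLZ.
Qed.

HB.instance Definition _ :=
  isNuAlgebra.Build K multiplier mmulA mmul_linearl mmul_linearr.

End Multiplier.

Arguments mone {K} A.
Notation "'M(' A )" := (multiplier A%type) (format "'M(' A )") : type_scope.

Section StarMultiplier.
Variables (K : numClosedFieldType) (A : starAlgType K).

(* m^* a = (a^* m)^* and a m^* = (m a^* )^* *)
Program Definition mstar (m : M(A)) : M(A) :=
  @Multiplier K A (fun a => star (mulR m (star a))) (fun a => star (mulL m (star a)))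
    _ _ _ _ _.
Next Obligation.
by move=> m k a b; rewrite starD starZ mulR_linear starD starZ conjCK.
Qed.
Next Obligation.
by move=> m k a b; rewrite starD starZ mulL_linear starD starZ conjCK.
Qed.
Next Obligation. by move=> m a b; rewrite starM mulRM starM starK. Qed.
Next Obligation. by move=> m a b; rewrite starM mulLM starM starK. Qed.
Next Obligation.
by move=> m a b; rewrite -{1}(starK a) -starM -mulLR starM starK.
Qed.

Lemma mstarK : involutive mstar.
Proof. by move=> m; apply: multiplierP => a /=; rewrite !starK. Qed.

Lemma mstarD : {morph mstar : m n / m + n}.
Proof. by move=> m n; apply: multiplierP => a /=; rewrite starD. Qed.

Lemma mstarZ k (m : M(A)) : mstar (k *: m) = k^* *: mstar m.
Proof. by apply: multiplierP => a /=; rewrite starZ. Qed.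

Lemma mstarM (m n : M(A)) : mstar (m • n) = mstar n • mstar m.
Proof. by apply: multiplierP => a /=; rewrite !starK. Qed.

HB.instance Definition _ :=
  hasStar.Build K (multiplier A) mstarK mstarD mstarZ mstarM.

End StarMultiplier.

Section TensorMultiplier.
Variables (K : comPzRingType) (A B : nuAlgType K).

(* The canonical map M(A) x M(B) -> M(A ⊗ B). *)
Program Definition mtensor (m : M(A)) (n : M(B)) : M(A ⊗ B) :=
  @Multiplier K (A ⊗ B)%type (tmap (mulL m) (mulL n)) (tmap (mulR m) (mulR n)) _ _ _ _ _.
Next Obligation. by move=> m n; apply: tmap_linear; apply: mulL_linear. Qed.
Next Obligation. by move=> m n; apply: tmap_linear; apply: mulR_linear. Qed.
Next Obligation.
move=> m n x y; have lin := tmap_linear (mulL_linear m) (mulL_linear n).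
elim/tensor_ind: x => [|x x' ihx ihx'|a b].
- have E : tmap (mulL m) (mulL n) 0 = 0.
    by have := lin (-1) 0 0; rewrite scaler0 addr0 scaleN1r addNr.
  by rewrite nmul0l E nmul0l.
- have D u v : tmap (mulL m) (mulL n) (u + v) =
      tmap (mulL m) (mulL n) u + tmap (mulL m) (mulL n) v.
    by have := lin 1 u v; rewrite !scale1r.
  by rewrite !(nmulDl, D) ihx ihx'.
move: y; apply: tensor_eq.
- by move=> k y y'; rewrite nmulDr nmulZr lin.
- by move=> k y y'; rewrite nmulDr nmulZr.
move=> a' b'; rewrite nmul_pure !tmapE; try exact: mulL_linear.
by rewrite nmul_pure !mulLM.
Qed.
Next Obligation.
move=> m n x y; have lin := tmap_linear (mulR_linear m) (mulR_linear n).
elim/tensor_ind: x => [|x x' ihx ihx'|a b].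
- have E : tmap (mulR m) (mulR n) 0 = 0.
    by have := lin (-1) 0 0; rewrite scaler0 addr0 scaleN1r addNr.
  by rewrite !nmul0l E.
- have D u v : tmap (mulR m) (mulR n) (u + v) =
      tmap (mulR m) (mulR n) u + tmap (mulR m) (mulR n) v.
    by have := lin 1 u v; rewrite !scale1r.
  by rewrite !(nmulDl, D) ihx ihx'.
move: y; apply: tensor_eq.
- by move=> k y y'; rewrite nmulDr nmulZr lin.
- by move=> k y y'; rewrite lin nmulDr nmulZr.
move=> a' b'; rewrite nmul_pure !tmapE; try exact: mulR_linear.
by rewrite nmul_pure !mulRM.
Qed.
Next Obligation.
move=> m n x y; have linL := tmap_linear (mulL_linear m) (mulL_linear n).
have linR := tmap_linear (mulR_linear m) (mulR_linear n).
elim/tensor_ind: x => [|x x' ihx ihx'|a b].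
- have E : tmap (mulR m) (mulR n) 0 = 0.
    by have := linR (-1) 0 0; rewrite scaler0 addr0 scaleN1r addNr.
  by rewrite E !nmul0l.
- have D u v : tmap (mulR m) (mulR n) (u + v) =
      tmap (mulR m) (mulR n) u + tmap (mulR m) (mulR n) v.
    by have := linR 1 u v; rewrite !scale1r.
  by rewrite !(nmulDl, D) ihx ihx'.
move: y; apply: tensor_eq.
- by move=> k y y'; rewrite linL nmulDr nmulZr.
- by move=> k y y'; rewrite nmulDr nmulZr.
move=> a' b'; rewrite !tmapE; try exact: mulL_linear; try exact: mulR_linear.
by rewrite !nmul_pure !mulLR.
Qed.

End TensorMultiplier.

Notation "m ⊠ n" := (mtensor m n) (at level 40, left associativity) : ring_scope.


Section Subspaces.
Variable (K : pzRingType).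

Definition subspace (V : lmodType K) (C : set V) := GRing.submod_closed [in C].

Definition span (V : lmodType K) (S : set V) : set V := smallest (@subspace V) S.

End Subspaces.

(* V ⊗ C as a subspace of V ⊗ W. *)
Definition tensor_sub (K : comPzRingType) (V W : lmodType K) (C : set W) : set (V ⊗ W) :=
  span [set v ⊗ w | v in [set: V] & w in C].

Definition star_subalgebra (K : numClosedFieldType) (A : starAlgType K) (C : set A) :=
  [/\ subspace C,
      forall a b, C a -> C b -> C (a • b)
    & forall a, C a -> C (star a)].


Definition nondegenerate_hom (K : comPzRingType) (A B : nuAlgType K) (f : A -> M(B)) :=
  span [set mulL (f a) b | a in [set: A] & b in [set: B]] = setT /\
  span [set mulR (f a) b | a in [set: A] & b in [set: B]] = setT.

(* n is the image of m under the extension M(A) -> M(B) of the nondegenerate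
   homomorphism f : A -> M(B): such an n exists and is unique. *)
Definition extension_at (K : comPzRingType) (A B : nuAlgType K) (f : A -> M(B))
    (m : M(A)) (n : M(B)) :=
  forall a, n • f a = f (mulL m a) /\ f a • n = f (mulR m a).

Section Comultiplication.
Variables (K : numClosedFieldType) (A : starAlgType K) (Delta : A -> M(A ⊗ A)).

Definition Delta_id : A ⊗ A -> M((A ⊗ A) ⊗ A) :=
  tlift (fun a b => Delta a ⊠ membed b).
Definition id_Delta : A ⊗ A -> M(A ⊗ (A ⊗ A)) :=
  tlift (fun a b => membed a ⊠ Delta b).

(* m and n correspond under (A ⊗ A) ⊗ A = A ⊗ (A ⊗ A). *)
Definition massoc (m : M((A ⊗ A) ⊗ A)) (n : M(A ⊗ (A ⊗ A))) :=
  forall x, tassoc (mulL m x) = mulL n (tassoc x) /\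
            tassoc (mulR m x) = mulR n (tassoc x).

(* (Delta ⊗ id) Delta = (id ⊗ Delta) Delta, with Delta ⊗ id and id ⊗ Delta
   extended to M(A ⊗ A). *)
Definition coassociative := forall a,
  exists m n, [/\ extension_at Delta_id (Delta a) m,
                  extension_at id_Delta (Delta a) n & massoc m n].

Definition leg1 (a : A) : M(A ⊗ A) := membed a ⊠ mone A.
Definition leg2 (a : A) : M(A ⊗ A) := mone A ⊠ membed a.

Record multiplier_hopf_star : Prop := MultiplierHopfStar {
  mhs_nondegenerate_product : nondegenerate_product A;
  mhs_star_hom : star_hom Delta;
  mhs_nondegenerate_hom : nondegenerate_hom Delta;
  mhs_coassociative : coassociative;
  mhs_T1 : exists T1 : A ⊗ A -> A ⊗ A, [/\ linear T1, bijective T1 &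
    forall a b, membed (T1 (a ⊗ b)) = Delta a • leg2 b];
  mhs_T2 : exists T2 : A ⊗ A -> A ⊗ A, [/\ linear T2, bijective T2 &
    forall a b, membed (T2 (a ⊗ b)) = leg1 a • Delta b]
}.

Record group_like_projection (h : A) : Prop := GroupLikeProjection {
  glp_neq0 : h <> 0;
  glp_idem : h • h = h;
  glp_star : star h = h;
  glp_Delta : Delta h • leg2 h = membed (h ⊗ h)
}.

(* Delta(a)(a' ⊗ 1) lies in A ⊗ C for all a', where A ⊗ A is viewed inside
   M(A ⊗ A) through membed. *)
Definition right_leg_in (a : A) (C : set A) :=
  forall a', (@membed K (A ⊗ A)%type @` tensor_sub (V := A) C) (Delta a • leg1 a').

(* [smallest] is the intersection of all such C; it is again such a subspace,
   since A ⊗ _ commutes with intersections of subspaces. *)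
Definition right_leg (a : A) : set A :=
  smallest [set C | subspace C /\ right_leg_in a C] set0.

End Comultiplication.

(* Main.v *)
(* Slicing identifies the right leg C of Delta(h) with the span of the elements
   (f ⊗ id)(Delta(h)(a ⊗ 1)), f a linear functional: since functionals separate
   points from subspaces, x is in A ⊗ C iff all slices of x are in C.

   Coassociativity gives Delta(C)(A ⊗ 1) <= A ⊗ C. For star-invariance,
   (a ⊗ 1)Delta(h) is in A ⊗ C because its products with all b ⊗ 1 are.
   Applying id ⊗ Delta to Delta(h)(1 ⊗ h) = h ⊗ h yields
   Delta(h)_13 Delta(h)_23 = T1^-1_12 (h ⊗ Delta(h)) with
   T1(a ⊗ b) = Delta(a)(1 ⊗ b), so its third leg is in C; hence
   Delta(h)(1 ⊗ c) has right leg in C for c in C, which gives C C <= C.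
   Finally, if c is in C, then applying the counit epsilon ⊗ id to
   Delta(h)(1 ⊗ c) gives h c in C, and h c = f(h a) h for the slice
   c = (f ⊗ id)(Delta(h)(a ⊗ 1)); choosing f(h a) = 1 shows that h is in C. *)

Require Import Defs.
From HB Require Import structures.
From mathcomp Require Import all_boot all_order all_algebra.
From mathcomp Require Import complex.
From mathcomp Require Import boolp classical_sets reals.

Set Implicit Arguments.
Unset Strict Implicit.
Unset Printing Implicit Defensive.

Import GRing.Theory Num.Theory.
Local Open Scope classical_set_scope.
Local Open Scope ring_scope.

(** * Subspaces and spans as predicates *)

Section Spans.
Variables (K : pzRingType) (V : lmodType K).
Implicit Types C S : set V.

Lemma subspaceP C :
  subspace C <-> C 0 /\ forall k x y, C x -> C y -> C (k *: x + y).
Proof.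
split=> -[C0 CD]; split; try exact/mem_set.
- exact/set_mem.
- by move=> k x y Cx Cy; apply/set_mem/CD; apply/mem_set.
- by move=> k x y /set_mem Cx /set_mem Cy; apply/mem_set/CD.
Qed.

Lemma subspace_0 : subspace [set 0 : V].
Proof. by apply/subspaceP; split=> // k x y /= -> ->; rewrite scaler0 addr0. Qed.

Section Closure.
Variables (C : set V) (subC : subspace C).

Lemma subspace0 : C 0. Proof. by have /subspaceP[] := subC. Qed.

Lemma subspaceD x y : C x -> C y -> C (x + y).
Proof.
by move=> Cx Cy; have /subspaceP[_ /(_ 1 x y)] := subC; rewrite scale1r; apply.
Qed.

Lemma subspaceZ k x : C x -> C (k *: x).
Proof.
by move=> Cx; have /subspaceP[C0 /(_ k x 0)] := subC; rewrite addr0; apply.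
Qed.

End Closure.

Lemma span_subspace S : subspace (Defs.span S).
Proof.
apply/subspaceP; split=> [C [subC _]|k x y Cx Cy C CP]; first exact: subspace0.
have [subC _] := CP.
by apply: subspaceD => //; [apply: subspaceZ => //; apply: Cx | apply: Cy].
Qed.

Lemma sub_gen_span S : S `<=` Defs.span S.
Proof. exact: sub_gen_smallest. Qed.

Lemma span_ind S C : subspace C -> S `<=` C -> Defs.span S `<=` C.
Proof. by move=> subC SC; apply: smallest_sub. Qed.

End Spans.

Arguments subspace_0 {K} V.

Lemma subspace_preimage (K : pzRingType) (V W : lmodType K) (f : {linear V -> W})
    (C : set W) : subspace C -> subspace (f @^-1` C).
Proof.
move=> subC; apply/subspaceP; split=> [|k x y /= Cx Cy].
  by rewrite /= linear0; apply: subspace0.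
by rewrite linearP; apply: subspaceD => //; apply: subspaceZ.
Qed.

Definition linear_of (K : pzRingType) (V W : lmodType K) (f : V -> W)
    (f_lin : linear f) : {linear V -> W} :=
  HB.pack f (GRing.isLinear.Build K V W *:%R f f_lin).

(** * Linear functionals separating points from subspaces *)

Section Separation.
Variables (K : fieldType) (V : lmodType K).

(** By Zorn there is a subspace [M] maximal among those containing [S] and avoiding [v]; then V is
    the direct sum of [M] and the line of [v], and [f] reads off the coefficient of [v]. *)
Lemma separating_functional (S : set V) (v : V) : subspace S -> ~ S v ->
  exists f : {linear V -> K^o}, (forall x, S x -> f x = 0) /\ f v = 1.
Proof.
move=> subS Sv.
(* The last condition is [S `<=` X] weakened to admit the union of the empty
   chain. *)
pose P := [set X : set V | [/\ forall k x y, X x -> X y -> X (k *: x + y),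
  ~ X v & forall x, X x -> S `<=` X]].
have [F FP Ftot|M [[MD Mv MS] Mmax]] := @Zorn_bigcup V P.
  split.
  - move=> k x y [X FX Xx] [Y FY Yy].
    have [XY|YX] := Ftot _ _ FX FY.
      by exists Y => //; have [YD _ _] := FP _ FY; apply: YD => //; apply: XY.
    by exists X => //; have [XD _ _] := FP _ FX; apply: XD => //; apply: YX.
  - by move=> [X FX Xv]; have [_] := FP _ FX.
  - move=> x [X FX Xx] s Ss; exists X => //.
    by have [_ _ XS] := FP _ FX; apply: XS Xx _ Ss.
(* An empty [M] would not be maximal, since [S] itself is in [P]. *)
have SM : S `<=` M.
  have [[x Mx]|M0] := pselect (exists x, M x); first exact: MS Mx.
  have /subspaceP[_ SD] := subS.
  have [] := Mmax S; last by split=> // x Sx.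
  split=> [x Mx|/(_ 0 (subspace0 subS)) Mz]; first by case: M0; exists x.
  by apply: M0; exists 0.
have M0 : M 0 by apply: SM; apply: subspace0.
have MZ k x : M x -> M (k *: x) by move=> Mx; rewrite -[_ *: _]addr0; apply: MD.
(* For [u] outside [M], maximality forces [v] into [X], the sum of [M] and the line of [u]; as [v]
   is not in [M], its coefficient on [u] is invertible. *)
have coefP u : {k : K | M (u - k *: v)}.
  apply: cid; have [Mu|Mu] := pselect (M u).
    by exists 0; rewrite scale0r subr0.
  pose X := [set x | exists2 k : K, M (x - k *: u) & True].
  have MX : M `<=` X by move=> x Mx; exists 0 => //; rewrite scale0r subr0.
  have Xu : X u by exists 1 => //; rewrite scale1r subrr.
  have Xv : X v.
    apply: contrapT => nXv; have [] := Mmax X; first by split=> // /(_ u Xu).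
    split=> //; last by move=> x _; apply: subset_trans SM MX.
    move=> k x y [a Ma _] [b Mb _]; exists (k * a + b) => //.
    rewrite (_ : _ - _ = k *: (x - a *: u) + (y - b *: u)); first exact: MD.
    by rewrite scalerBr scalerDl scalerA opprD addrACA.
  case: Xv => k Mk _; have k0 : k != 0.
    by apply: contra_notN Mv => /eqP k0; rewrite k0 scale0r subr0 in Mk.
  exists k^-1; rewrite (_ : _ - _ = - k^-1 *: (v - k *: u)); first exact: MZ.
  by rewrite scalerBr !scaleNr opprK scalerA mulVf // scale1r addrC.
pose f u : K^o := projT1 (coefP u).
have fP u : M (u - f u *: v) by rewrite /f; case: (coefP u).
have f_uniq u k : M (u - k *: v) -> f u = k.
  move=> Mk; apply/eqP; rewrite -subr_eq0; apply: contra_notT Mv => fk.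
  rewrite (_ : v = (f u - k)^-1 *: (- 1 *: (u - f u *: v) + (u - k *: v))).
    by apply: MZ; apply: MD.
  rewrite scaleN1r opprB addrA subrK -scalerBl scalerA mulVf ?scale1r //.
have f_lin : linear f.
  move=> k x y; apply: f_uniq; rewrite (_ : _ - _ =
    k *: (x - f x *: v) + (y - f y *: v)); first exact: MD.
  by rewrite scalerBr scalerDl scalerA opprD addrACA.
exists (linear_of f_lin).
split=> [x Sx|] /=; apply: f_uniq.
  by rewrite scale0r subr0; apply: SM.
by rewrite scale1r subrr.
Qed.

Lemma functional_eq0 (v : V) :
  (forall f : {linear V -> K^o}, f v = 0) -> v = 0.
Proof.
move=> fv; apply: contrapT => v0.
have [f [_ /eqP]] := separating_functional (subspace_0 V) v0.
by rewrite fv eq_sym oner_eq0.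
Qed.

End Separation.

(** * Linear maps and slices on tensor products *)

Section TensorLinear.
Variable K : comPzRingType.

HB.instance Definition _ (V V' W W' : lmodType K) (f : {linear V -> V'})
    (g : {linear W -> W'}) :=
  GRing.isLinear.Build K (V ⊗ W)%type (V' ⊗ W')%type *:%R (tmap f g)
    (tmap_linear (linearP f) (linearP g)).

Lemma tmap_pure (V V' W W' : lmodType K) (f : {linear V -> V'})
    (g : {linear W -> W'}) v w : tmap f g (v ⊗ w) = f v ⊗ g w.
Proof. by apply: tmapE; apply: linearP. Qed.

Lemma pure0l (V W : lmodType K) (w : W) : (0 : V) ⊗ w = 0.
Proof. by apply: (addIr (0 ⊗ w)); rewrite -pureDl !add0r. Qed.

Lemma pure0r (V W : lmodType K) (v : V) : v ⊗ (0 : W) = 0.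
Proof. by apply: (addIr (v ⊗ 0)); rewrite -pureDr !add0r. Qed.

Lemma pure_linearl (V W : lmodType K) (w : W) : linear (fun v : V => v ⊗ w).
Proof. exact: (@pure_bilin K V W).1. Qed.

Lemma pure_linearr (V W : lmodType K) (v : V) : linear (fun w : W => v ⊗ w).
Proof. exact: (@pure_bilin K V W).2. Qed.

HB.instance Definition _ (V W : lmodType K) (v : V) :=
  GRing.isLinear.Build K W (V ⊗ W)%type *:%R (@pure K V W v) (@pure_linearr V W v).

Section Slices.
Variables V W : lmodType K.

(** These are f ⊗ id and id ⊗ f, followed by the identifications of K ⊗ W with W and of V ⊗ K with
    V. *)
Definition slice1 (f : V -> K^o) : V ⊗ W -> W := tlift (fun v w => (f v : K) *: w).
Definition slice2 (f : W -> K^o) : V ⊗ W -> V := tlift (fun v w => (f w : K) *: v).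

Arguments slice1 : simpl never.
Arguments slice2 : simpl never.

Lemma slice1_bilin (f : {linear V -> K^o}) : bilin (fun v (w : W) => (f v : K) *: w).
Proof.
split=> [w|v] k x y; first by rewrite linearP scalerDl scalerA.
by rewrite scalerDr !scalerA mulrC.
Qed.

Lemma slice2_bilin (f : {linear W -> K^o}) : bilin (fun (v : V) w => (f w : K) *: v).
Proof.
split=> [w|v] k x y; last by rewrite linearP scalerDl scalerA.
by rewrite scalerDr !scalerA mulrC.
Qed.

HB.instance Definition _ (f : {linear V -> K^o}) :=
  GRing.isLinear.Build K (V ⊗ W)%type W *:%R (slice1 f) (tlift_linear (slice1_bilin f)).
HB.instance Definition _ (f : {linear W -> K^o}) :=
  GRing.isLinear.Build K (V ⊗ W)%type V *:%R (slice2 f) (tlift_linear (slice2_bilin f)).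

Lemma slice1_pure (f : {linear V -> K^o}) v w : slice1 f (v ⊗ w) = (f v : K) *: w.
Proof. exact/tliftE/bilin_balanced/slice1_bilin. Qed.

Lemma slice2_pure (f : {linear W -> K^o}) v w : slice2 f (v ⊗ w) = (f w : K) *: v.
Proof. exact/tliftE/bilin_balanced/slice2_bilin. Qed.

(** Both sides are f ⊗ g evaluated at [x]. *)
Lemma slice_comm (f : {linear V -> K^o}) (g : {linear W -> K^o}) x :
  g (slice1 f x) = f (slice2 g x).
Proof.
elim/tensor_ind: x => [|x y ihx ihy|v w]; first by rewrite !linear0.
  by rewrite !linearD ihx ihy.
by rewrite slice1_pure slice2_pure !linearZ /= /GRing.scale /= mulrC.
Qed.

End Slices.

End TensorLinear.

(** * The subspaces V ⊗ C and their detection by slices *)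

Section TensorSub.
Variables (K : fieldType) (V W : lmodType K) (C : set W).

Lemma tensor_sub_subspace : subspace (tensor_sub (V := V) C).
Proof. exact: span_subspace. Qed.

Lemma tensor_sub0 : tensor_sub C (0 : V ⊗ W).
Proof. exact: (subspace0 tensor_sub_subspace). Qed.

Lemma tensor_subD (x y : V ⊗ W) :
  tensor_sub C x -> tensor_sub C y -> tensor_sub C (x + y).
Proof. exact: (subspaceD tensor_sub_subspace). Qed.

Lemma tensor_subZ k (x : V ⊗ W) : tensor_sub C x -> tensor_sub C (k *: x).
Proof. exact: (subspaceZ tensor_sub_subspace). Qed.

Lemma tensor_sub_pure v w : C w -> tensor_sub C (v ⊗ w : V ⊗ W).
Proof. by move=> Cw; apply: sub_gen_span; exists v => //; exists w. Qed.

Lemma tensor_sub_ind (D : set (V ⊗ W)) : subspace D ->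
  (forall v w, C w -> D (v ⊗ w)) -> tensor_sub C `<=` D.
Proof. by move=> subD CD; apply: span_ind => // _ [v _ [w Cw <-]]; apply: CD. Qed.

End TensorSub.

Section TensorSubSlices.
Variables (K : fieldType) (V W : lmodType K).

Lemma tensor_sub_slice2_eq0 (C : set W) (f : {linear W -> K^o}) (x : V ⊗ W) :
  (forall c, C c -> f c = 0) -> tensor_sub C x -> slice2 f x = 0.
Proof.
move=> f0; suff : tensor_sub (V := V) C `<=` slice2 f @^-1` [set 0] by apply.
apply: tensor_sub_ind => [|v w Cw]; first exact/subspace_preimage/subspace_0.
by rewrite /preimage /mkset slice2_pure f0 // scale0r.
Qed.

(** Induction on a list representing [x], with [C] varying: a term v ⊗ w is split off while [C] is
    enlarged by [w]. *)
Lemma tensor_sub_slice2 (C : set W) (x : V ⊗ W) : subspace C ->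
  tensor_sub C x <->
  forall f : {linear W -> K^o}, (forall c, C c -> f c = 0) -> slice2 f x = 0.
Proof.
move=> subC; split=> [Cx f f0|]; first exact: tensor_sub_slice2_eq0 f0 Cx.
rewrite -(reprK_tpi x); elim: (repr x) C subC => [|[v w] s IHs] C subC fx.
  by rewrite tpi_sum big_nil; apply: subspace0; apply: tensor_sub_subspace.
have E : tpi ((v, w) :: s) = v ⊗ w + tpi s by rewrite -cat1s tpi_cat.
rewrite E in fx *.
(* [D] is the sum of [C] and the line of [w]; a functional vanishing on [D] does not see the term v
   ⊗ w, so the induction hypothesis places the rest in V ⊗ D. *)
pose D := [set u | exists k, C (u - k *: w)].
have subD : subspace D.
  apply/subspaceP; split=> [|k a b [ka Ca] [kb Cb]].
    by exists 0; rewrite scale0r subr0; apply: subspace0.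
  exists (k * ka + kb); rewrite (_ : _ - _ = k *: (a - ka *: w) + (b - kb *: w)).
    by apply: subspaceD => //; apply: subspaceZ.
  by rewrite scalerBr scalerDl scalerA opprD addrACA.
have /(IHs _ subD) Dx (f : {linear W -> K^o}) :
    (forall c, D c -> f c = 0) -> slice2 f (tpi s) = 0.
  move=> fD; have := fx f; rewrite linearD /= slice2_pure fD.
    rewrite scale0r add0r; apply=> c Cc; apply: fD.
    by exists 0; rewrite scale0r subr0.
  by exists 1; rewrite scale1r subrr; apply: subspace0.
have [u [y [Cy Ey]]] : exists u y, tensor_sub C y /\ tpi s = u ⊗ w + y.
  suff : tensor_sub (V := V) D `<=`
      [set t | exists u y, tensor_sub C y /\ t = u ⊗ w + y] by apply.
  apply: tensor_sub_ind => [|a b [k Cb]].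
    apply/subspaceP; split=> [|k a b [u [y [Cy ->]]] [u' [y' [Cy' ->]]]].
      exists 0, 0; rewrite pure0l addr0; split=> //.
      exact: tensor_sub0.
    exists (k *: u + u'), (k *: y + y'); split.
      apply: tensor_subD => //.
      by apply: tensor_subZ.
    by rewrite pureDl pureZl scalerDr addrACA.
  exists (k *: a), (a ⊗ (b - k *: w)); split; first exact: tensor_sub_pure.
  by rewrite pureZl -pureZr -pureDr addrC subrK.
rewrite Ey addrA -pureDl in fx *.
apply: tensor_subD => //.
(* What remains is (v + u) ⊗ w modulo V ⊗ C: either [w] is in [C], or a functional that kills [C]
   and has value 1 at [w] shows that v + u = 0. *)
have [Cw|Cw] := pselect (C w); first exact: tensor_sub_pure.
have [f [fC fw]] := separating_functional subC Cw.
have := fx f fC; rewrite linearD /= slice2_pure fw scale1r.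
rewrite (tensor_sub_slice2_eq0 fC Cy) addr0 => ->.
by rewrite pure0l; apply: tensor_sub0.
Qed.

(** For [g] vanishing on [C], every [f] satisfies f([slice2 g x]) = g([slice1 f x]) = 0, so the
    criterion by [slice2] applies. *)
Lemma tensor_sub_slice1 (C : set W) (x : V ⊗ W) : subspace C ->
  tensor_sub C x <-> forall f : {linear V -> K^o}, C (slice1 f x).
Proof.
move=> subC; split=> [Cx f|Cx].
  suff : tensor_sub (V := V) C `<=` slice1 f @^-1` C by apply.
  apply: tensor_sub_ind => [|v w Cw]; first exact: subspace_preimage.
  by rewrite /preimage /mkset slice1_pure; apply: subspaceZ.
apply/(tensor_sub_slice2 _ subC) => g gC; apply: functional_eq0 => f.
by rewrite -slice_comm gC.
Qed.

Lemma slice1_eq0 (x : V ⊗ W) :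
  (forall f : {linear V -> K^o}, slice1 f x = 0) -> x = 0.
Proof.
move=> fx; suff : tensor_sub (V := V) [set 0 : W] x.
  suff H : tensor_sub (V := V) [set 0 : W] `<=` [set 0] by move/H.
  apply: tensor_sub_ind => [|v w /= ->]; last exact: pure0r.
  exact: subspace_0.
by apply/tensor_sub_slice1 => //; apply: subspace_0.
Qed.

End TensorSubSlices.

Arguments leg1 : simpl never.
Arguments leg2 : simpl never.
Arguments mtensor : simpl never.

(** The slices of [x] are tested against B, then against A: slicing the second leg with g(- b) and
    multiplying by [a] gives a slice of x(a ⊗ b). *)
Lemma tensor_nondegenerate (K : fieldType) (A B : nuAlgType K) :
  (forall a : A, (forall b, a • b = 0) -> a = 0) ->
  (forall a : B, (forall b, a • b = 0) -> a = 0) ->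
  forall x : A ⊗ B, (forall a b, x • (a ⊗ b) = 0) -> x = 0.
Proof.
move=> ndA ndB x x0; apply: slice1_eq0 => f; apply: ndB => b.
apply: functional_eq0 => g.
have gb_lin : linear (fun c : B => g (c • b) : K^o).
  by move=> k c c'; rewrite nmulDl nmulZl linearP.
pose gb := linear_of gb_lin.
have -> : g (slice1 f x • b) = gb (slice1 f x) by [].
rewrite slice_comm; suff -> : slice2 gb x = 0 by rewrite linear0.
apply: ndA => a; transitivity (slice2 g (x • (a ⊗ b))); last by rewrite x0 linear0.
elim/tensor_ind: x {x0} => [|x y ihx ihy|v w].
- by rewrite nmul0l !linear0 nmul0l.
- by rewrite nmulDl !linearD /= nmulDl ihx ihy.
- by rewrite nmul_pure !slice2_pure nmulZl.
Qed.

(** * Multipliers as linear maps *)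

Section MultiplierLinear.
Variable K : comPzRingType.

HB.instance Definition _ (A : nuAlgType K) (m : M(A)) :=
  GRing.isLinear.Build K A A *:%R (mulL m) (mulL_linear m).
HB.instance Definition _ (A : nuAlgType K) (m : M(A)) :=
  GRing.isLinear.Build K A A *:%R (mulR m) (mulR_linear m).
HB.instance Definition _ (A : nuAlgType K) (a : A) :=
  GRing.isLinear.Build K A A *:%R (nmul a) (nmul_linearr a).

Variables A B : nuAlgType K.

Lemma mulL_comb k (m n : M(A)) a : mulL (k *: m + n) a = k *: mulL m a + mulL n a.
Proof. by []. Qed.

Lemma mulR_comb k (m n : M(A)) a : mulR (k *: m + n) a = k *: mulR m a + mulR n a.
Proof. by []. Qed.

Lemma mulL_mtensor (m : M(A)) (n : M(B)) a b :
  mulL (m ⊠ n) (a ⊗ b) = mulL m a ⊗ mulL n b.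
Proof. by apply: tmapE; apply: mulL_linear. Qed.

Lemma mulR_mtensor (m : M(A)) (n : M(B)) a b :
  mulR (m ⊠ n) (a ⊗ b) = mulR m a ⊗ mulR n b.
Proof. by apply: tmapE; apply: mulR_linear. Qed.

Lemma multiplier_tensorP (m n : M(A ⊗ B)) :
  (forall a b, mulL m (a ⊗ b) = mulL n (a ⊗ b)) ->
  (forall a b, mulR m (a ⊗ b) = mulR n (a ⊗ b)) -> m = n.
Proof.
move=> mnL mnR; apply: multiplierP.
  by apply: tensor_eq; [apply: mulL_linear..|].
by apply: tensor_eq; [apply: mulR_linear..|].
Qed.

End MultiplierLinear.

Lemma mtensor_bilin (K : comPzRingType) (A B : nuAlgType K) :
  bilin (fun (m : M(A)) (n : M(B)) => m ⊠ n).
Proof.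
split=> [n|m] k x y; apply: multiplier_tensorP => a b.
- by rewrite mulL_comb !mulL_mtensor mulL_comb pureDl pureZl.
- by rewrite mulR_comb !mulR_mtensor mulR_comb pureDl pureZl.
- by rewrite mulL_comb !mulL_mtensor mulL_comb pureDr pureZr.
- by rewrite mulR_comb !mulR_mtensor mulR_comb pureDr pureZr.
Qed.

Lemma membed_linear (K : comPzRingType) (A : nuAlgType K) : linear (@membed K A).
Proof.
by move=> k a b; apply: multiplierP => c /=;
  rewrite ?nmulDl ?nmulZl ?nmulDr ?nmulZr.
Qed.

(** * The associativity isomorphism and its compatibility with products and slices *)

Section Tassoc.
Variable K : comPzRingType.

HB.instance Definition _ (U V W : lmodType K) :=
  GRing.isLinear.Build K ((U ⊗ V) ⊗ W)%type (U ⊗ (V ⊗ W))%type *:%R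
    (@tassoc K U V W) (tlift_linear (tassoc_bilin U V W)).

Lemma tassoc_inj (U V W : lmodType K) : injective (@tassoc K U V W).
Proof.
(* The left inverse sends u ⊗ (v ⊗ w) to (u ⊗ v) ⊗ w. *)
pose g (u : U) (t : V ⊗ W) : (U ⊗ V) ⊗ W := tmap (pure u) idfun t.
have gB : bilin g.
  split=> [t|u]; last exact: linearP.
  move=> k u u'; rewrite /g; elim/tensor_ind: t => [|x y ihx ihy|v w].
  - by rewrite !linear0 addr0.
  - by rewrite !linearD /= ihx ihy addrACA.
  - by rewrite !tmap_pure /= !pureDl !pureZl.
pose gL := linear_of (tlift_linear gB).
apply: (can_inj (g := gL)) => x.
elim/tensor_ind: x => [|x y ihx ihy|x w].
- by rewrite !linear0.
- by rewrite !linearD; congr (_ + _).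
elim/tensor_ind: x => [|x y ihx ihy|u v].
- by rewrite pure0l !linear0.
- by rewrite pureDl !linearD; congr (_ + _).
- by rewrite tassocE /= (tliftE (bilin_balanced gB)) /g tmap_pure.
Qed.

Lemma tassocM (A B D : nuAlgType K) (x y : (A ⊗ B) ⊗ D) :
  tassoc (x • y) = tassoc x • tassoc y.
Proof.
elim/tensor_ind: x => [|x x' ihx ihx'|x d].
- by rewrite nmul0l linear0 nmul0l.
- by rewrite nmulDl !linearD /= nmulDl ihx ihx'.
elim/tensor_ind: y => [|y y' ihy ihy'|y d'].
- by rewrite !linear0.
- by rewrite nmulDr !linearD /= ihy ihy'.
rewrite nmul_pure; elim/tensor_ind: x => [|x x' ihx ihx'|a b].
- by rewrite nmul0l !pure0l linear0 nmul0l.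
- by rewrite nmulDl !pureDl !linearD /= nmulDl ihx ihx'.
elim/tensor_ind: y => [|y y' ihy ihy'|a' b'].
- by rewrite nmul0r !pure0l !linear0.
- by rewrite nmulDr !pureDl !linearD /= ihy ihy'.
by rewrite nmul_pure !tassocE !nmul_pure.
Qed.

Lemma tassoc_tmapl (U U' V W : lmodType K) (f : {linear U -> U'}) (x : (U ⊗ V) ⊗ W) :
  tassoc (tmap (tmap f idfun) idfun x) = tmap f idfun (tassoc x).
Proof.
elim/tensor_ind: x => [|x y ihx ihy|x w].
- by rewrite !linear0.
- by rewrite !linearD /= ihx ihy.
elim/tensor_ind: x => [|x y ihx ihy|u v].
- by rewrite tmap_pure linear0 !pure0l !linear0.
- by rewrite pureDl !linearD /= ihx ihy.
- by rewrite tassocE !tmap_pure /= tmap_pure tassocE.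
Qed.

Lemma slice1_tassoc (U V W : lmodType K) (f : {linear U -> K^o}) (x : U ⊗ V) (w : W) :
  slice1 f (tassoc (x ⊗ w)) = slice1 f x ⊗ w.
Proof.
elim/tensor_ind: x => [|x y ihx ihy|u v].
- by rewrite pure0l !linear0 pure0l.
- by rewrite pureDl !linearD /= pureDl ihx ihy.
- by rewrite tassocE !slice1_pure pureZl.
Qed.

Lemma slice1_tmapr (V W W' : lmodType K) (f : {linear V -> K^o})
    (g : {linear W -> W'}) x :
  slice1 f (tmap idfun g x) = g (slice1 f x).
Proof.
elim/tensor_ind: x => [|x y ihx ihy|v w].
- by rewrite !linear0.
- by rewrite !linearD /= ihx ihy.
- by rewrite tmap_pure !slice1_pure linearZ.
Qed.

End Tassoc.

Lemma tensor_sub_tmap (K : fieldType) (V V' W : lmodType K) (f : {linear V -> V'})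
    (C : set W) x :
  tensor_sub C x -> tensor_sub C (tmap f idfun x).
Proof.
suff : tensor_sub (V := V) C `<=` tmap f idfun @^-1` tensor_sub C by apply.
apply: tensor_sub_ind => [|v w Cw].
  exact/subspace_preimage/tensor_sub_subspace.
by rewrite /preimage /mkset tmap_pure; apply: tensor_sub_pure.
Qed.

Lemma tensor_sub_slice1_tassoc (K : fieldType) (U V W : lmodType K)
    (f : {linear U -> K^o}) (C : set W) (x : (U ⊗ V) ⊗ W) :
  tensor_sub C x -> tensor_sub C (slice1 f (tassoc x)).
Proof.
suff : tensor_sub (V := (U ⊗ V)%type) C `<=`
  (slice1 f \o @tassoc K U V W) @^-1` tensor_sub C by apply.
apply: tensor_sub_ind => [|v w Cw].
  exact/subspace_preimage/tensor_sub_subspace.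
by rewrite /preimage /mkset /= slice1_tassoc; apply: tensor_sub_pure.
Qed.

Lemma nondegenerate_ext (K : pzRingType) (A : nuAlgType K) (x y : A) :
  (forall a : A, (forall b, a • b = 0) -> a = 0) ->
  (forall b, x • b = y • b) -> x = y.
Proof.
move=> nd xy; apply/eqP; rewrite -subr_eq0; apply/eqP/nd => b.
by rewrite -scaleN1r nmulDl nmulZl xy scaleN1r subrr.
Qed.

(** * The right leg of a comultiplied element *)

Section MultiplierHopf.
Variables (K : numClosedFieldType) (A : starAlgType K) (Delta : A -> M(A ⊗ A)).
Hypothesis DeltaP : multiplier_hopf_star Delta.

Local Notation T := (A ⊗ A)%type.

Lemma nondegA (a : A) : (forall b, a • b = 0) -> a = 0.
Proof. by have [[+ _] _ _ _ _ _] := DeltaP; apply. Qed.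

Lemma nondegAA (x : T) : (forall t, x • t = 0) -> x = 0.
Proof. by move=> x0; apply: tensor_nondegenerate => //; apply: nondegA. Qed.

Lemma tensor_ext (x y : T) : (forall a b, x • (a ⊗ b) = y • (a ⊗ b)) -> x = y.
Proof.
move=> xy; apply: nondegenerate_ext nondegAA _.
by apply: tensor_eq => //; apply: nmul_linearr.
Qed.

Lemma tensor3_extl (x y : T ⊗ A) :
  (forall t c, x • (t ⊗ c) = y • (t ⊗ c)) -> x = y.
Proof.
move=> xy; apply: nondegenerate_ext => [z z0|].
  by apply: tensor_nondegenerate => //; [apply: nondegAA | apply: nondegA].
by apply: tensor_eq => //; apply: nmul_linearr.
Qed.

Lemma tensor3_extr (x y : A ⊗ T) :
  (forall a t, x • (a ⊗ t) = y • (a ⊗ t)) -> x = y.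
Proof.
move=> xy; apply: nondegenerate_ext => [z z0|].
  by apply: tensor_nondegenerate => //; [apply: nondegA | apply: nondegAA].
by apply: tensor_eq => //; apply: nmul_linearr.
Qed.

Lemma membed_inj : injective (@membed K T).
Proof.
move=> x y xy; apply: nondegenerate_ext nondegAA _ => b.
by rewrite -[x • b]/(mulL (membed x) b) xy.
Qed.

Lemma Delta_linear : linear Delta. Proof. by have [_ [[]]] := DeltaP. Qed.

Lemma DeltaM a b : Delta (a • b) = Delta a • Delta b.
Proof. by have [_ [[]]] := DeltaP. Qed.

Lemma Delta_star a : Delta (star a) = star (Delta a).
Proof. by have [_ [_]] := DeltaP. Qed.

(** * Coassociativity on elements *)

Lemma actD_linear (t : T) : linear (fun a => mulL (Delta a) t).
Proof. by move=> k a b; rewrite Delta_linear mulL_comb. Qed.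

Definition actD (t : T) : {linear A -> T} := linear_of (actD_linear t).

(* [Dl t x] is (Delta ⊗ id)(x) (t ⊗ 1) and [Dr t x] is (id ⊗ Delta)(x) (1 ⊗ t). *)
Definition Dl (t : T) : T -> T ⊗ A := tmap (actD t) idfun.
Definition Dr (t : T) : T -> A ⊗ T := tmap idfun (actD t).

HB.instance Definition _ t := GRing.Linear.on (Dl t).
HB.instance Definition _ t := GRing.Linear.on (Dr t).

Lemma Dl_pure t a b : Dl t (a ⊗ b) = mulL (Delta a) t ⊗ b.
Proof. exact: tmap_pure. Qed.

Lemma Dr_pure t a b : Dr t (a ⊗ b) = a ⊗ mulL (Delta b) t.
Proof. exact: tmap_pure. Qed.

Lemma Dl_linear x : linear (Dl^~ x).
Proof.
move=> k t t'; elim/tensor_ind: x => [|x y ihx ihy|a b].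
- by rewrite !linear0 addr0.
- by rewrite !linearD /= ihx ihy addrACA.
- by rewrite !Dl_pure linearP pureDl pureZl.
Qed.

Lemma Dr_linear x : linear (Dr^~ x).
Proof.
move=> k t t'; elim/tensor_ind: x => [|x y ihx ihy|a b].
- by rewrite !linear0 addr0.
- by rewrite !linearD /= ihx ihy addrACA.
- by rewrite !Dr_pure linearP pureDr pureZr.
Qed.

Lemma Dl0 x : Dl 0 x = 0.
Proof. exact: (linear0 (linear_of (Dl_linear x))). Qed.

Lemma Dr0 x : Dr 0 x = 0.
Proof. exact: (linear0 (linear_of (Dr_linear x))). Qed.

(** Used with nondegeneracy to compare elements of the triple tensor product: the factor [c] is
    absorbed into the second leg of [x], the factor [s] into [t]. *)
Lemma Dl_mul t x s c : Dl t x • (s ⊗ c) = Dl (t • s) (mulR (leg2 c) x).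
Proof.
elim/tensor_ind: x => [|x y ihx ihy|a b].
- by rewrite !linear0 nmul0l.
- by rewrite !linearD /= nmulDl ihx ihy.
- by rewrite mulR_mtensor !Dl_pure nmul_pure mulLM.
Qed.

Lemma Dr_mul t x s c : Dr t x • (c ⊗ s) = Dr (t • s) (mulR (leg1 c) x).
Proof.
elim/tensor_ind: x => [|x y ihx ihy|a b].
- by rewrite !linear0 nmul0l.
- by rewrite !linearD /= nmulDl ihx ihy.
- by rewrite mulR_mtensor !Dr_pure nmul_pure mulLM.
Qed.

Lemma Dl_Delta t x a : Dl (mulL (Delta a) t) x = Dl t (mulR (leg1 a) x).
Proof.
elim/tensor_ind: x => [|x y ihx ihy|b c].
- by rewrite !linear0.
- by rewrite !linearD /= ihx ihy.
- by rewrite mulR_mtensor !Dl_pure DeltaM.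
Qed.

Lemma Dr_Delta t x a : Dr (mulL (Delta a) t) x = Dr t (mulR (leg2 a) x).
Proof.
elim/tensor_ind: x => [|x y ihx ihy|b c].
- by rewrite !linear0.
- by rewrite !linearD /= ihx ihy.
- by rewrite mulR_mtensor !Dr_pure DeltaM.
Qed.

(** Nondegeneracy of Delta: a linear condition on [t] need only be checked on the elements
    Delta(a)t, which span A ⊗ A. *)
Lemma Delta_span (S : set T) :
  subspace S -> (forall a t, S (mulL (Delta a) t)) -> forall t, S t.
Proof.
move=> subS SD t; have [_ _ [spanD _] _ _ _] := DeltaP.
suff : setT `<=` S by apply.
by rewrite -spanD; apply: span_ind => // _ [a _ [b _ <-]].
Qed.

(** Links the multiplier [Delta_id], through which coassociativity is stated, to the elementwise map
    [Dl]. *)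
Lemma Delta_id_mul x t c :
  mulL (Delta_id Delta x) (t ⊗ c) = Dl t (mulR (leg2 c) x).
Proof.
have B : bilin (fun a b : A => Delta a ⊠ membed b).
  have [Ml Mr] := mtensor_bilin T A.
  split=> [w|v] k a b /=.
    by rewrite Delta_linear; apply: Ml.
  by rewrite membed_linear; apply: Mr.
elim/tensor_ind: x => [|x y ihx ihy|a b].
- by rewrite /Delta_id tlift0 ?linear0 //; apply: bilin_balanced.
- rewrite /Delta_id tliftD; last exact: bilin_balanced.
  by rewrite !linearD /= -ihx -ihy.
- rewrite /Delta_id tliftE; last exact: bilin_balanced.
  by rewrite mulL_mtensor mulR_mtensor Dl_pure.
Qed.

Lemma id_Delta_mul x t c :
  mulL (id_Delta Delta x) (c ⊗ t) = Dr t (mulR (leg1 c) x).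
Proof.
have B : bilin (fun a b : A => membed a ⊠ Delta b).
  have [Ml Mr] := mtensor_bilin A T.
  split=> [w|v] k a b /=.
    by rewrite membed_linear; apply: Ml.
  by rewrite Delta_linear; apply: Mr.
elim/tensor_ind: x => [|x y ihx ihy|a b].
- by rewrite /id_Delta tlift0 ?linear0 //; apply: bilin_balanced.
- rewrite /id_Delta tliftD; last exact: bilin_balanced.
  by rewrite !linearD /= -ihx -ihy.
- rewrite /id_Delta tliftE; last exact: bilin_balanced.
  by rewrite mulL_mtensor mulR_mtensor Dr_pure.
Qed.

(* m = (Delta ⊗ id)Delta(a) and n = (id ⊗ Delta)Delta(a). *)
Definition Delta3 (a : A) (m : M(T ⊗ A)) (n : M(A ⊗ T)) :=
  [/\ forall t x, mulL m (Dl t x) = Dl t (mulL (Delta a) x),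
      forall t x, mulL n (Dr t x) = Dr t (mulL (Delta a) x) &
      forall x, tassoc (mulL m x) = mulL n (tassoc x)].

(** Multiplied on the right by pure tensors, the first two identities become the defining relations
    of the extensions of Delta ⊗ id and id ⊗ Delta at Delta(a). *)
Lemma Delta3_ex a : exists m n, Delta3 a m n.
Proof.
have [_ _ _ /(_ a)[m [n [mP nP mn]]] _ _] := DeltaP; exists m, n; split.
- move=> t x; apply: tensor3_extl => s c.
  rewrite -mulLM !Dl_mul -!Delta_id_mul.
  by have [<- _] := mP x.
- move=> t x; apply: tensor3_extr => c s.
  rewrite -mulLM !Dr_mul -!id_Delta_mul.
  by have [<- _] := nP x.
- by move=> x; have [] := mn x.
Qed.

(** * The canonical maps and the elements Delta(a)(b ⊗ 1) *)

Variables T1 T1V T2 : {linear T -> T}.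
Hypotheses (T1K : cancel T1 T1V) (T1VK : cancel T1V T1).
Hypothesis T2_surj : forall x, exists y, T2 y = x.
Hypothesis T1E : forall a b, membed (T1 (a ⊗ b)) = Delta a • leg2 b.
Hypothesis T2E : forall a b, membed (T2 (a ⊗ b)) = leg1 a • Delta b.

Lemma T1_mul a b t : T1 (a ⊗ b) • t = mulL (Delta a) (mulL (leg2 b) t).
Proof. by rewrite -[LHS]/(mulL (membed (T1 (a ⊗ b))) t) T1E. Qed.

Lemma T2_mul a b t : T2 (a ⊗ b) • t = mulL (leg1 a) (mulL (Delta b) t).
Proof. by rewrite -[LHS]/(mulL (membed (T2 (a ⊗ b))) t) T2E. Qed.

Lemma star_pure (a b : A) : star (a ⊗ b : T) = star a ⊗ star b.
Proof. exact: tstarE. Qed.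

Lemma mulL_star (m : M(T)) x : mulL (star m) x = star (mulR m (star x)).
Proof. by []. Qed.

Lemma mulR_star (m : M(T)) x : mulR (star m) x = star (mulL m (star x)).
Proof. by []. Qed.

Lemma star_leg1 (a : A) : star (leg1 a) = leg1 (star a).
Proof.
by apply: multiplier_tensorP => b c; rewrite ?mulL_star ?mulR_star star_pure
  ?mulR_mtensor ?mulL_mtensor star_pure /= starM !starK.
Qed.

Lemma star_leg2 (a : A) : star (leg2 a) = leg2 (star a).
Proof.
by apply: multiplier_tensorP => b c; rewrite ?mulL_star ?mulR_star star_pure
  ?mulR_mtensor ?mulL_mtensor star_pure /= starM !starK.
Qed.

Lemma star_membed (x : T) : star (membed x) = membed (star x).
Proof. by apply: multiplierP => t; rewrite ?mulL_star ?mulR_star /= starM starK. Qed.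

(* Delta(a)(b ⊗ 1), see [T3E]. *)
Definition T3 (a b : A) : T := star (T2 (star b ⊗ star a)).

Lemma T3E a b : membed (T3 a b) = Delta a • leg1 b.
Proof. by rewrite -star_membed T2E starM Delta_star // star_leg1 !starK. Qed.

Lemma T3_mul a b t : T3 a b • t = mulL (Delta a) (mulL (leg1 b) t).
Proof. by rewrite -[LHS]/(mulL (membed (T3 a b)) t) T3E. Qed.

Lemma T3_linear b : linear (T3^~ b).
Proof.
by move=> k a a'; rewrite /T3 starD starZ pureDr pureZr linearP starD starZ conjCK.
Qed.

Definition T3l b : {linear A -> T} := linear_of (T3_linear b).

(** Adjoints turn the surjectivity of [T2] into the fact that the Delta(a)(b ⊗ 1) span A ⊗ A. *)
Lemma T3_ind (P : T -> Prop) : P 0 -> (forall x y, P x -> P y -> P (x + y)) ->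
  (forall a b, P (T3 a b)) -> forall x, P x.
Proof.
move=> P0 PD PT x; have [y Ey] := T2_surj (star x); rewrite -[x]starK -Ey.
elim/tensor_ind: y {x Ey} => [|x y ihx ihy|a b].
- by rewrite linear0 star0.
- by rewrite linearD starD; apply: PD.
- by have := PT (star b) (star a); rewrite /T3 !starK.
Qed.

(** Associativity in M(A ⊗ A), tested on pure tensors; so are the companions below, for instance the
    two readings of (a ⊗ 1)Delta(b)(s ⊗ 1) through [T2] and [T3]. *)
Lemma mulR_leg1_T1 s a c : mulR (leg1 s) (T1 (a ⊗ c)) = mulL (Delta a) (s ⊗ c).
Proof.
apply: tensor_ext => x y.
by rewrite -mulLR T1_mul -mulLM nmul_pure !mulL_mtensor.
Qed.

Lemma mulR_leg2_T1 s a c : mulR (leg2 s) (T1 (a ⊗ c)) = T1 (a ⊗ (c • s)).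
Proof.
apply: tensor_ext => x y.
by rewrite -mulLR !T1_mul !mulL_mtensor /= nmulA.
Qed.

Lemma mulR_leg2_T3 s a b : mulR (leg2 s) (T3 a b) = mulL (Delta a) (b ⊗ s).
Proof.
apply: tensor_ext => x y.
by rewrite -mulLR T3_mul -mulLM nmul_pure !mulL_mtensor.
Qed.

Lemma mulR_leg1_T3 s a b : mulR (leg1 s) (T3 a b) = T3 a (b • s).
Proof.
apply: tensor_ext => x y.
by rewrite -mulLR !T3_mul !mulL_mtensor /= nmulA.
Qed.

Lemma mulR_leg1_T2 s a b : mulR (leg1 s) (T2 (a ⊗ b)) = mulL (leg1 a) (T3 b s).
Proof. by apply: tensor_ext => x y; rewrite -mulLR T2_mul -mulLM T3_mul. Qed.

Lemma mulR_leg2_T2 s a b : mulR (leg2 s) (T2 (a ⊗ b)) = mulL (leg1 a) (T1 (b ⊗ s)).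
Proof. by apply: tensor_ext => x y; rewrite -mulLR T2_mul -mulLM T1_mul. Qed.

Section Delta3.
Variables (a : A) (m : M(T ⊗ A)) (n : M(A ⊗ T)).
Hypothesis mn : Delta3 a m n.

(** For t = Delta(s)t', the factor Delta(s) moves into the first leg, and both sides become [m]
    applied to Delta(s)t' ⊗ c; such t span A ⊗ A. *)
Lemma Dl_T1 t c : Dl t (T1 (a ⊗ c)) = mulL m (t ⊗ c).
Proof.
have [mP _ _] := mn; move: t.
apply: (Delta_span (S := [set t | Dl t (T1 (a ⊗ c)) = mulL m (t ⊗ c)])).
  apply/subspaceP; split=> [|k x y /= Ex Ey].
    by rewrite /= Dl0 pure0l linear0.
  by rewrite Dl_linear Ex Ey pureDl pureZl linearP.
move=> s t /=.
by rewrite Dl_Delta mulR_leg1_T1 -mP Dl_pure.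
Qed.

Lemma Dr_T3 t b : Dr t (T3 a b) = mulL n (b ⊗ t).
Proof.
have [_ nP _] := mn; move: t.
apply: (Delta_span (S := [set t | Dr t (T3 a b) = mulL n (b ⊗ t)])).
  apply/subspaceP; split=> [|k x y /= Ex Ey].
    by rewrite /= Dr0 pure0r linear0.
  by rewrite Dr_linear Ex Ey pureDr pureZr linearP.
move=> s t /=.
by rewrite Dr_Delta mulR_leg2_T3 -nP Dr_pure.
Qed.

Lemma Dl_mulR_T3 t b c : Dl t (mulR (leg2 c) (T3 a b)) = mulL m (mulL (Delta b) t ⊗ c).
Proof. by have [mP _ _] := mn; rewrite mulR_leg2_T3 -mP Dl_pure. Qed.

End Delta3.

(** * The right leg as a span of slices, and its invariance *)

Lemma right_leg_span a :
  right_leg Delta a =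
  Defs.span [set slice1 f (T3 a b) | f in [set: {linear A -> K^o}] & b in [set: A]].
Proof.
(* The span of the slices has the property that defines the right leg, and every subspace with that
   property contains the slices. *)
apply/seteqP; split.
  apply: smallest_sub => //; split; first exact: span_subspace.
  move=> b; exists (T3 a b); last exact: T3E.
  apply/tensor_sub_slice1; first exact: span_subspace.
  by move=> f; apply: sub_gen_span; exists f => //; exists b.
move=> c Cc D [[subD legD] _]; apply: Cc; split=> // _ [f _ [b _ <-]].
have [x Dx] := legD b; rewrite -T3E => /membed_inj <- //.
by have /tensor_sub_slice1 := Dx; apply.
Qed.

Lemma right_leg_subspace a : subspace (right_leg Delta a).
Proof. by rewrite right_leg_span; apply: span_subspace. Qed.

Lemma right_leg_slice a (f : {linear A -> K^o}) b : right_leg Delta a (slice1 f (T3 a b)).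
Proof. by rewrite right_leg_span; apply: sub_gen_span; exists f => //; exists b. Qed.

Lemma right_leg_T3 a b : tensor_sub (right_leg Delta a) (T3 a b).
Proof.
apply/tensor_sub_slice1; first exact: right_leg_subspace.
by move=> f; apply: right_leg_slice.
Qed.

Lemma right_leg_ind a (S : set A) : subspace S ->
  (forall (f : {linear A -> K^o}) b, S (slice1 f (T3 a b))) -> right_leg Delta a `<=` S.
Proof.
move=> subS ST; rewrite right_leg_span; apply: span_ind => // _ [f _ [b _ <-]].
exact: ST.
Qed.

Lemma tensor3_extr_pure (x y : A ⊗ T) :
  (forall a b c, x • (a ⊗ (b ⊗ c)) = y • (a ⊗ (b ⊗ c))) -> x = y.
Proof.
move=> xy; apply: tensor3_extr => // a.
by apply: tensor_eq => //= k t t'; rewrite !linearP.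
Qed.

Lemma tensor3_extl_pure (x y : T ⊗ A) :
  (forall a b c, x • ((a ⊗ b) ⊗ c) = y • ((a ⊗ b) ⊗ c)) -> x = y.
Proof.
move=> xy; apply: tassoc_inj; apply: tensor3_extr_pure => a b c.
by rewrite -tassocE -!tassocM xy.
Qed.

Lemma T3l_mul q x s c :
  tmap (T3l q) idfun x • (s ⊗ c) = Dl (mulL (leg1 q) s) (mulR (leg2 c) x).
Proof.
elim/tensor_ind: x => [|x y ihx ihy|a b].
- by rewrite !linear0 nmul0l.
- by rewrite !linearD /= nmulDl ihx ihy.
- by rewrite tmap_pure nmul_pure mulR_mtensor Dl_pure /= T3_mul.
Qed.

Lemma T3r_mul q x s c :
  tmap idfun (T3l q) x • (c ⊗ s) = Dr (mulL (leg1 q) s) (mulR (leg1 c) x).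
Proof.
elim/tensor_ind: x => [|x y ihx ihy|a b].
- by rewrite !linear0 nmul0l.
- by rewrite !linearD /= nmulDl ihx ihy.
- by rewrite tmap_pure nmul_pure mulR_mtensor Dr_pure /= T3_mul.
Qed.

(** For c = (f ⊗ id)(Delta(a)(d ⊗ 1)), coassociativity makes Delta(c)(b ⊗ 1) the slice by [f] of
    (Delta ⊗ id)Delta(a)(d ⊗ b ⊗ 1), so it suffices that the third leg of the latter is in [C]. *)
Lemma right_leg_invariant a c b :
  right_leg Delta a c -> tensor_sub (right_leg Delta a) (T3 c b).
Proof.
set C := right_leg Delta a; move: c.
apply: (@right_leg_ind a [set c | tensor_sub C (T3l b c)]).
  exact/subspace_preimage/tensor_sub_subspace.
move=> f d; rewrite /mkset -slice1_tmapr.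
have [m [n mn]] := Delta3_ex a.
(* [Z] is m(d ⊗ b ⊗ 1). When d ⊗ b is replaced by Delta(p)(q ⊗ 1), it becomes (Delta ⊗
   id)(Delta(a)(p ⊗ 1))(q ⊗ 1 ⊗ 1), whose third leg is that of Delta(a)(p ⊗ 1). *)
have [Z CZ ZE] : exists2 Z : T ⊗ A, tensor_sub C Z &
    forall s c, Z • (s ⊗ c) = mulL m (((d ⊗ b) • s) ⊗ c).
  elim/T3_ind: (d ⊗ b) => [|x y [X CX EX] [Y CY EY]|p q].
  - exists 0; first exact: tensor_sub0.
    by move=> s c; rewrite !nmul0l pure0l linear0.
  - exists (X + Y); first exact: tensor_subD.
    by move=> s c; rewrite !nmulDl pureDl linearD EX EY.
  - exists (tmap (T3l q) idfun (T3 a p)).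
      by apply: tensor_sub_tmap; apply: right_leg_T3.
    by move=> s c; rewrite T3l_mul (Dl_mulR_T3 mn) T3_mul.
suff -> : tmap idfun (T3l b) (T3 a d) = tassoc Z by apply: tensor_sub_slice1_tassoc.
apply: tensor3_extr_pure => x y z.
have [_ _ mnE] := mn.
rewrite T3r_mul mulR_leg1_T3 (Dr_T3 mn) mulL_mtensor /=.
by rewrite -[in RHS]tassocE -tassocM ZE mnE nmul_pure tassocE.
Qed.

Lemma tensor_sub_leg1 (C : set A) a x :
  tensor_sub C x -> tensor_sub C (mulL (leg1 a) x).
Proof. exact: tensor_sub_tmap. Qed.

Lemma tensor_sub_rleg1 (C : set A) a x :
  tensor_sub C x -> tensor_sub C (mulR (leg1 a) x).
Proof. exact: (@tensor_sub_tmap _ _ _ _ (mulR (membed a))). Qed.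

Lemma slice1_leg2 (f : {linear A -> K^o}) a x :
  slice1 f (mulR (leg2 a) x) = slice1 f x • a.
Proof. exact: (slice1_tmapr f (mulR (membed a))). Qed.

(** * The right leg of a group-like projection: products and adjoints *)

Section GroupLike.
Variable h : A.
Hypothesis hP : group_like_projection Delta h.

(* Coassociativity and Delta(h)(1 ⊗ h) = h ⊗ h give
   (Delta ⊗ id)Delta(h) (1 ⊗ Delta(h)) = h ⊗ Delta(h), that is,
   (T1 ⊗ id)(Delta(h)_13 Delta(h)_23) = h ⊗ Delta(h); inverting T1 shows that the
   third leg of Delta(h)_13 Delta(h)_23 is in the right leg of Delta(h). In
   the proof, Y is h_1 ⊗ h'_1 b ⊗ h_2 h'_2, where h' is a second copy of h. *)
Lemma right_leg_T1 c :
  right_leg Delta h c -> tensor_sub (right_leg Delta h) (T1 (h ⊗ c)).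
Proof.
set C := right_leg Delta h; move: c.
apply: (@right_leg_ind h [set c | tensor_sub C ((T1 \o pure h) c)]).
  exact/subspace_preimage/tensor_sub_subspace.
move=> f b; rewrite /mkset /=.
have [m [n mn]] := Delta3_ex h.
have [mP nP mnE] := mn.
have [Y [YT YE]] : exists Y : T ⊗ A,
    T1 (h ⊗ slice1 f (T3 h b)) = tmap (slice2 f) idfun Y /\
    forall x y z, tassoc (tmap T1 idfun Y • ((x ⊗ y) ⊗ z)) =
      mulL n (x ⊗ (T3 h b • (y ⊗ z))).
  elim/tensor_ind: (T3 h b) => [|X X' [Y [YT YE]] [Y' [YT' YE']]|p q].
  - exists 0; split=> [|x y z]; first by rewrite !linear0.
    by rewrite linear0 !nmul0l !linear0.
  - exists (Y + Y'); split=> [|x y z]; first by rewrite !linearD /= YT YT'.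
    by rewrite !linearD /= !nmulDl !linearD /= YE YE'.
  (* The leg [p] is inserted between the two legs of Delta(h)(1 ⊗ q); [slice2 f] contracts it to the
     scalar f(p). *)
  have [ip ipE] : exists ip : {linear A -> T}, forall u, ip u = u ⊗ p.
    by exists (linear_of (@pure_linearl K A A p)).
  exists (tmap ip idfun (T1 (h ⊗ q))); split=> [|x y z].
    rewrite slice1_pure pureZr linearZ /=.
    elim/tensor_ind: (T1 _) => [|X X' ihX ihX'|u v].
    - by rewrite !linear0.
    - by rewrite !linearD /= ihX ihX'.
    - by rewrite !tmap_pure /= ipE slice2_pure pureZl.
  have -> : forall X : T, tmap T1 idfun (tmap ip idfun X) • ((x ⊗ y) ⊗ z) =
      Dl (x ⊗ (p • y)) (mulR (leg2 z) X).
    elim/tensor_ind => [|X X' ihX ihX'|u v].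
    - by rewrite !linear0 nmul0l.
    - by rewrite !linearD /= nmulDl ihX ihX'.
    - by rewrite !tmap_pure ipE nmul_pure T1_mul mulR_mtensor Dl_pure mulL_mtensor.
  by rewrite mulR_leg2_T1 (Dl_T1 mn) mnE tassocE nmul_pure.
have YZ : tmap T1 idfun Y = tmap (pure h) idfun (T3 h b).
  apply: tensor3_extl_pure => x y z; apply: tassoc_inj.
  rewrite YE T3_mul -(Dr_pure _ x) nP.
  (* This is Delta(h)(1 ⊗ h) = h ⊗ h applied to x ⊗ h, with hh = h. *)
  have -> : mulL (Delta h) (x ⊗ h) = (h • x) ⊗ h.
    have := congr1 (fun k => mulL k (x ⊗ h)) (glp_Delta hP).
    rewrite -[LHS]/(mulL (Delta h) (mulL (leg2 h) (x ⊗ h))) mulL_mtensor /=.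
    by rewrite nmul_pure (glp_idem hP).
  rewrite Dr_pure -T3_mul tassocM tassocE.
  have -> : tassoc (tmap (pure h) idfun (T3 h b)) = h ⊗ T3 h b.
    elim/tensor_ind: (T3 h b) => [|X X' ihX ihX'|u v].
    - by rewrite !linear0.
    - by rewrite !linearD /= ihX ihX'.
    - by rewrite tmap_pure tassocE.
  by rewrite nmul_pure.
rewrite YT; apply: tensor_sub_tmap.
have -> : Y = tmap T1V idfun (tmap T1 idfun Y).
  elim/tensor_ind: Y {YT YE YZ} => [|X X' ihX ihX'|u v].
  - by rewrite !linear0.
  - by rewrite !linearD /= -ihX -ihX'.
  - by rewrite !tmap_pure /= T1K.
by rewrite YZ; do 2!apply: tensor_sub_tmap; apply: right_leg_T3.
Qed.

(** For c = (f ⊗ id)(Delta(h)(a ⊗ 1)), the product cd is the slice by [f] of Delta(h)(1 ⊗ d)(a ⊗ 1),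
    and Delta(h)(1 ⊗ d) is in A ⊗ C. *)
Lemma right_leg_mul c d :
  right_leg Delta h c -> right_leg Delta h d -> right_leg Delta h (c • d).
Proof.
move=> Cc Cd; move: c Cc.
apply: (@right_leg_ind h (mulR (membed d) @^-1` right_leg Delta h)).
  exact/subspace_preimage/right_leg_subspace.
move=> f a; rewrite /preimage /mkset /= -slice1_leg2 mulR_leg2_T3 -mulR_leg1_T1.
move: f; apply/tensor_sub_slice1; first exact: right_leg_subspace.
by apply: tensor_sub_rleg1; apply: right_leg_T1.
Qed.

Lemma right_leg_star c : right_leg Delta h c -> right_leg Delta h (star c).
Proof.
move: c; set C := right_leg Delta h; have subC : subspace C := right_leg_subspace h.
apply: (@right_leg_ind h [set c | C (star c)]).
  apply/subspaceP; split=> [|k x y /= Cx Cy].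
    by rewrite /= star0; apply: (subspace0 subC).
  by rewrite starD starZ; apply: (subspaceD subC) => //; apply: (subspaceZ subC).
move=> f a; rewrite /mkset.
(* The adjoint functional: conjugating twice restores linearity, and slicing an adjoint by it gives
   the adjoint of the slice by [f]. *)
have fs_lin : linear (fun v : A => (f (star v) : K)^* : K^o).
  by move=> k x y; rewrite starD starZ linearP rmorphD rmorphM /= conjCK.
have -> : star (slice1 f (T3 h a)) = slice1 (linear_of fs_lin) (T2 (star a ⊗ h)).
  rewrite -[in RHS](glp_star hP) -[T2 _]starK -/(T3 h a).
  elim/tensor_ind: (T3 h a) => [|X X' ihX ihX'|u v].
  - by rewrite !(linear0, star0).
  - by rewrite !(linearD, starD) /= ihX ihX'.
  - by rewrite star_pure !slice1_pure /= starK starZ.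
move: (linear_of _); apply/tensor_sub_slice1 => //.
(* Slicing the second leg leaves an element of A, which nondegeneracy allows to be tested by right
   multiplication by [b], that is, on (star a ⊗ 1)Delta(h)(b ⊗ 1). *)
apply/tensor_sub_slice2 => // g gC; apply: nondegA => b.
have -> : slice2 g (T2 (star a ⊗ h)) • b =
    slice2 g (mulR (leg1 b) (T2 (star a ⊗ h))).
  elim/tensor_ind: (T2 _) => [|X X' ihX ihX'|u v].
  - by rewrite !linear0 nmul0l.
  - by rewrite !linearD /= nmulDl ihX ihX'.
  - by rewrite mulR_mtensor !slice2_pure nmulZl.
rewrite mulR_leg1_T2; apply: tensor_sub_slice2_eq0 gC _.
by apply: tensor_sub_leg1; apply: right_leg_T3.
Qed.

End GroupLike.

(** * The counit, and [h] in its own right leg *)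

Lemma nmul_bilin : bilin (@nmul K A).
Proof. by split; [apply: nmul_linearl | apply: nmul_linearr]. Qed.

Definition nmulT : {linear T -> A} := linear_of (tlift_linear nmul_bilin).

Lemma nmulT_pure a b : nmulT (a ⊗ b) = a • b.
Proof. exact: (tliftE (bilin_balanced nmul_bilin)). Qed.

Lemma T2_linearr c : linear (fun a => T2 (c ⊗ a)).
Proof. by move=> k a b; rewrite !linearP. Qed.

(** Coassociativity: for y = a ⊗ b both sides are (c ⊗ 1 ⊗ 1)(Delta ⊗ id)Delta(a)(1 ⊗ 1 ⊗ b). *)
Lemma pentagon_T2 c y : let T2c := linear_of (T2_linearr c) in
  tmap idfun T1 (tassoc (tmap T2c idfun y)) = tassoc (tmap T2c idfun (T1 y)).
Proof.
move=> T2c; elim/tensor_ind: y => [|x y ihx ihy|a b]; first by rewrite !linear0.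
  by rewrite !linearD /= ihx ihy.
have [m [n mn]] := Delta3_ex a; have [_ _ mnE] := mn.
apply: tensor3_extr_pure => x y z; rewrite tmap_pure /=.
have -> : forall X : T, tmap idfun T1 (tassoc (X ⊗ b)) • (x ⊗ (y ⊗ z)) =
    Dr (y ⊗ (b • z)) (mulR (leg1 x) X).
  elim/tensor_ind=> [|X X' ihX ihX'|u v].
  - by rewrite pure0l !linear0 nmul0l.
  - by rewrite pureDl !linearD /= nmulDl ihX ihX'.
  - by rewrite tassocE tmap_pure nmul_pure T1_mul mulR_mtensor Dr_pure mulL_mtensor.
have -> : forall X : T, tassoc (tmap T2c idfun X) • (x ⊗ (y ⊗ z)) =
    tmap (nmul c) idfun (tassoc (Dl (x ⊗ y) (mulR (leg2 z) X))).
  move=> X; rewrite -tassocE -tassocM -tassoc_tmapl; congr tassoc.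
  elim/tensor_ind: X => [|X X' ihX ihX'|u v].
  - by rewrite !linear0 nmul0l.
  - by rewrite !linearD /= nmulDl ihX ihX'.
  - by rewrite mulR_mtensor Dl_pure !tmap_pure nmul_pure /= T2_mul.
rewrite mulR_leg1_T2 mulR_leg2_T1 (Dl_T1 mn) mnE tassocE -(Dr_T3 mn).
elim/tensor_ind: (T3 a x) => [|X X' ihX ihX'|u v].
- by rewrite !linear0.
- by rewrite !linearD /= ihX ihX'.
- by rewrite mulL_mtensor !Dr_pure tmap_pure.
Qed.

(* [nmulT (T1V (u ⊗ b))] is epsilon(u) b for the counit epsilon. *)
Lemma counit_subspace (C : set A) x : subspace C ->
  tensor_sub C x -> C (nmulT (T1V x)).
Proof.
move=> subC; move: x.
apply: (@tensor_sub_ind _ _ _ _ ((nmulT \o T1V) @^-1` C)).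
  exact: subspace_preimage.
move=> u b Cb; suff: C (nmulT (T1V (u ⊗ b))) by [].
have [->|u0] := pselect (u = 0).
  by rewrite pure0l !linear0; apply: (subspace0 subC).
have [f [_ fu]] := separating_functional (subspace_0 A) u0.
(* u ⊗ u serves as a tensor whose slice by [f] is [u]; this reduces [u] to slices of (c ⊗
   1)Delta(a). *)
have [y Ey] := T2_surj (u ⊗ u).
have {fu Ey u0} -> : u = slice1 f (T2 y) by rewrite Ey slice1_pure fu scale1r.
elim/tensor_ind: y => [|x y ihx ihy|c a].
- by rewrite !linear0 pure0l !linear0; apply: (subspace0 subC).
- by rewrite !linearD pureDl !linearD; apply: (subspaceD subC).
pose T2c := linear_of (T2_linearr c).
(* The preceding coassociativity identity with [T1] inverted, sliced by [f] in the first leg. *)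
have -> : T1V (slice1 f (T2 (c ⊗ a)) ⊗ b) =
    slice1 f (tassoc (tmap T2c idfun (T1V (a ⊗ b)))).
  apply: (can_inj T1K); rewrite T1VK -slice1_tmapr pentagon_T2 T1VK tmap_pure.
  by rewrite slice1_tassoc.
(* Multiplying the last two legs of (c ⊗ 1)Delta(p) ⊗ q gives (c ⊗ 1)Delta(p)(1 ⊗ q), so [T1]
   reappears and cancels [T1V]; the final value is f(ca)b. *)
have -> : forall X, nmulT (slice1 f (tassoc (tmap T2c idfun X))) =
    slice1 f (mulL (leg1 c) (T1 X)).
  elim/tensor_ind=> [|X X' ihX ihX'|p q]; first by rewrite !linear0.
    by rewrite !linearD; congr (_ + _).
  by rewrite tmap_pure slice1_tassoc -mulR_leg2_T2 slice1_leg2 nmulT_pure.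
by rewrite T1VK mulL_mtensor slice1_pure; apply: (subspaceZ subC).
Qed.

Lemma right_leg_group_like h : group_like_projection Delta h -> right_leg Delta h h.
Proof.
move=> hP; have subC := right_leg_subspace h.
have [b hb0] : exists b, h • b <> 0.
  apply: contrapT => hb0; apply: (glp_neq0 hP); apply: nondegA => b.
  by apply: contrapT => hb; apply: hb0; exists b.
have [f [_ fhb]] := separating_functional (subspace_0 A) hb0.
have := counit_subspace subC (right_leg_T1 hP (right_leg_slice f b)).
rewrite T1K nmulT_pure.
have -> : h • slice1 f (T3 h b) = slice1 f (mulL (leg2 h) (T3 h b)).
  by rewrite -(slice1_tmapr f (nmul h)).
suff -> : mulL (leg2 h) (T3 h b) = (h • b) ⊗ h by rewrite slice1_pure fhb scale1r.
(* The adjoint of Delta(h)(1 ⊗ h) = h ⊗ h, by self-adjointness of [h]. *)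
have hl : leg2 h • Delta h = membed (h ⊗ h).
  rewrite -[leg2 h • _]starK starM -Delta_star star_leg2 (glp_star hP).
  by rewrite (glp_Delta hP) star_membed star_pure (glp_star hP).
apply: tensor_ext => x y; rewrite -mulLM T3_mul.
rewrite -[LHS]/(mulL (leg2 h • Delta h) _) hl mulL_mtensor /= !nmul_pure.
by rewrite nmulA.
Qed.

End MultiplierHopf.

(** * The conclusions over the complex numbers *)

Local Open Scope complex_scope.

Theorem proposition3p3 (R : realType) (A : starAlgType R[i])
    (Delta : A -> M(A ⊗ A)) (h : A) :
  multiplier_hopf_star Delta ->
  group_like_projection Delta h ->
  let C := right_leg Delta h in
  [/\ star_subalgebra C,
      forall c a : A, C c ->
        (@membed _ (A ⊗ A)%type @` tensor_sub (V := A) C) (Delta c • leg1 a)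
    & C h].
Proof.
move=> DeltaP hP C; have [_ _ _ _] := DeltaP.
move=> [T1 [T1_lin [T1V T1K T1VK] T1E]] [T2 [T2_lin [T2V _ T2VK] T2E]].
(* The inverse of a linear bijection is linear, so it can be packed with [T1] and [T2] as the linear
   maps assumed above. *)
have T1V_lin : linear T1V.
  by move=> k x y; apply: (can_inj T1K); rewrite T1VK T1_lin !T1VK.
pose L1 := linear_of T1_lin; pose L1V := linear_of T1V_lin.
pose L2 := linear_of T2_lin.
have L1K : cancel L1 L1V by [].
have L1VK : cancel L1V L1 by [].
have L1E a b : membed (L1 (a ⊗ b)) = Delta a • leg2 b by apply: T1E.
have L2E a b : membed (L2 (a ⊗ b)) = leg1 a • Delta b by apply: T2E.
have L2_surj x : exists y, L2 y = x by exists (T2V x); apply: T2VK.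
split; first split.
- exact: (right_leg_subspace DeltaP L2E).
- by move=> a b; apply: (right_leg_mul DeltaP L1K L1E L2E hP).
- by move=> a; apply: (right_leg_star DeltaP L2E hP).
- move=> c a Cc; exists (T3 L2 c a); last exact: (T3E DeltaP L2E).
  exact: (right_leg_invariant DeltaP L2_surj L2E).
- exact: (right_leg_group_like DeltaP L1K L1VK L2_surj L1E L2E hP).
Qed.
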